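(* For every constant $\epsilon>0$ there is a polynomial $P_\epsilon$ such that for all $n,m\ge1$ there is a truthful sequential posted-price mechanism for online combinatorial auctions with $n$ buyers and $m$ items that uses at most $P_\epsilon(n,m)$ samples and is $(2+\epsilon)$-competitive for XOS (in particular, submodular) valuations. That is, for every product distribution $D=D_1\times\dots\times D_n$ over profiles of XOS valuations on $[m]$, if the mechanism is given $k\le P_\epsilon(n,m)$ independent samples $\mathbf{s}^1,\dots,\mathbf{s}^k\sim D$ and is run on an independent profile $\mathbf{v}\sim D$, with $X_i$ the set received by buyer $i$, then $$\mathbb{E}\Big[\sum_{i=1}^n v_i(X_i)\Big]\ \ge\ \frac{1}{2+\epsilon}\,\mathbb{E}\Big[\max_{(A_1,\dots,A_n)}\sum_{i=1}^n v_i(A_i)\Big],$$ where the maximum is over all tuples of pairwise disjoint sets $A_1,\dots,A_n\subseteq[m]$.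
   Context: Valuations: a valuation is a function $v:2^{[m]}\to\mathbb{R}_{\ge0}$ that is normalized ($v(\emptyset)=0$) and monotone ($v(S)\le v(T)$ for $S\subseteq T$). $v$ is XOS if there is a finite collection of additive functions $a_\ell(B)=\sum_{j\in B}a_\ell(j)$ with $a_\ell(j)\ge0$ such that $v(B)=\max_\ell a_\ell(B)$ for all $B\subseteq[m]$. (Monotone, normalized) submodular valuations are XOS. Sequential posted-price mechanism from samples: the distributions $D_i$ are unknown; the mechanism sees the sample profiles $\mathbf{s}^1,\dots,\mathbf{s}^k$ in advance. Buyers arrive in the fixed order $1,\dots,n$. Let $M_i\subseteq[m]$ be the set of unsold items when buyer $i$ arrives. The mechanism posts a price vector $\mathbf{p}^i\in\mathbb{R}_{\ge0}^m$, which may depend on the samples, on $v_1,\dots,v_{i-1}$ and on internal randomness, but not on $v_i$ (this makes the mechanism truthful, i.e. dominant strategy incentive compatible). Buyer $i$ receives a set $X_i\subseteq M_i$ maximizing the utility $v_i(B)-\sum_{j\in B}p^i_j$ over $B\subseteq M_i$ and pays $\sum_{j\in X_i}p^i_j$. If there are several utility-maximizing sets, one of them is selected by a (possibly randomized) tie-breaking rule specified by the mechanism. Expectations are over samples, valuations and internal randomness. *)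

(* Defs.v *)
From HB Require Import structures.
From mathcomp Require Import all_boot all_order all_algebra.
From mathcomp Require Import all_classical all_reals all_analysis.

Set Implicit Arguments.
Unset Strict Implicit.
Unset Printing Implicit Defensive.

Import Order.TTheory GRing.Theory Num.Theory.

Local Open Scope classical_set_scope.
Local Open Scope ring_scope.

Section product_probability.
Context {R : realType} {d : measure_display} {T : measurableType d}.

Definition consT (n : nat) (x : T * n.-tuple T) : n.+1.-tuple T :=
  [tuple of x.1 :: x.2].

Lemma measurable_consT (n : nat) : measurable_fun [set: _] (@consT n).
Proof. by apply: measurable_cons. Qed.

HB.instance Definition _ (n : nat) :=
  @isMeasurableFun.Build _ _ _ _ (@consT n) (@measurable_consT n).

(* D_1 x ... x D_n on the product sigma-algebra of n-tuples; it is
   characterized by [prod_probE] below. *)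
Fixpoint prod_prob (n : nat) : ('I_n -> probability T R) ->
    probability (n.-tuple T) R :=
  match n with
  | 0 => fun=> \d_([tuple] : 0.-tuple T)
  | n'.+1 => fun D => distribution
      (D ord0 \x prod_prob (fun i => D (lift ord0 i)))%E (@consT n')
  end.

Lemma measurable_tuple_rect (n : nat) (A : 'I_n -> set T) :
  (forall i, measurable (A i)) ->
  measurable [set x : n.-tuple T | forall i, A i (tnth x i)].
Proof.
move=> mA; rewrite (_ : [set _ | _] =
    \bigcap_(i in [set: 'I_n]) ((fun x : n.-tuple T => tnth x i) @^-1` A i)).
  apply: fin_bigcap_measurable => // i _.
  rewrite -[X in measurable X]setTI.
  exact: (@measurable_tnth _ _ n i measurableT _ (mA i)).
by apply/seteqP; split => x /= Ax i; [move=> _|]; exact: Ax.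
Qed.

Lemma prod_probE (n : nat) (D : 'I_n -> probability T R) (A : 'I_n -> set T) :
  (forall i, measurable (A i)) ->
  prod_prob D [set x | forall i, A i (tnth x i)] = (\prod_(i < n) D i (A i))%E.
Proof.
elim: n => [|n IHn] in D A *; move=> mA.
  by rewrite big_ord0 /= diracE mem_set // => -[].
rewrite big_ord_recl -IHn => [|i]; last exact: mA.
have mB := @measurable_tuple_rect n (fun i => A (lift ord0 i)) (fun i => mA _).
rewrite -product_measure1E; [|exact: mA|exact: mB].
rewrite [LHS]/= /distribution /pushforward.
congr (product_measure1 _ _ _); apply/seteqP; split => -[x t] /=.
  move=> At; split; first exact: (At ord0).
  by move=> i; have := At (lift ord0 i); rewrite tnthS.
move=> [Ax At] i; case: (unliftP ord0 i) => [j ->|-> //].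
by rewrite tnthS; exact: At.
Qed.

End product_probability.

(* A set function B |-> v(B) on the subsets of [m], stored as the tuple of its
   2^m values so that it carries the product (Borel) sigma-algebra. *)
Notation setfun R m := (#|{set 'I_m}|.-tuple R).

Notation profile R n m := (n.-tuple (setfun R m)).

Definition value (R : realType) (m : nat) (v : setfun R m)
    (B : {set 'I_m}) : R :=
  tnth v (enum_rank B).

Definition valuation (R : realType) (m : nat) (v : setfun R m) : Prop :=
  [/\ forall B : {set 'I_m}, 0 <= value v B,
      value v finset.set0 = 0 &
      forall S T : {set 'I_m}, S \subset T -> value v S <= value v T].

(* The collection of additive functions is nonempty and they are nonnegative,
   so the base value 0 of the iterated maximum is harmless. *)
Definition xos (R : realType) (m : nat) (v : setfun R m) : Prop :=
  valuation v /\
  exists (L : nat) (a : 'I_L.+1 -> 'I_m -> R),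
    (forall l j, 0 <= a l j) /\
    (forall B : {set 'I_m},
       value v B = \big[Num.max/0]_(l < L.+1) \sum_(j in B) a l j).

Definition allocation (n m : nat) (A : {ffun 'I_n -> {set 'I_m}}) : bool :=
  [forall i, forall j, (i != j) ==> [disjoint A i & A j]].

Definition welfare (R : realType) (n m : nat) (v : profile R n m)
    (A : 'I_n -> {set 'I_m}) : R :=
  \sum_(i < n) value (tnth v i) (A i).

(* For valuations every term is nonnegative, so the base value 0 is harmless. *)
Definition opt (R : realType) (n m : nat) (v : profile R n m) : R :=
  \big[Num.max/0]_(A : {ffun 'I_n -> {set 'I_m}} | allocation A) welfare v A.

Definition utility (R : realType) (m : nat) (v : setfun R m) (p : 'I_m -> R)
    (B : {set 'I_m}) : R :=
  value v B - \sum_(j in B) p j.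

Definition demand (R : realType) (m : nat) (v : setfun R m) (p : 'I_m -> R)
    (M : {set 'I_m}) : {set {set 'I_m}} :=
  [set B : {set 'I_m} | (B \subset M) &&
    [forall C : {set 'I_m},
       (C \subset M) ==> (utility v p C <= utility v p B)]]%SET.

(* [price i w s h] and [tie i w s h] may use the internal randomness [w], the
   samples [s] and the valuations [h] of the buyers before [i] (an [i]-tuple),
   hence also the set of unsold items, but not the valuation of buyer [i];
   [tie] moreover receives the family of utility-maximizing sets. *)
Record mechanism (R : realType) (n m k : nat) := Mechanism {
  seed_display : measure_display;
  seed : measurableType seed_display;
  seed_law : probability seed R;
  price : forall i : 'I_n, seed -> k.-tuple (profile R n m) ->
    i.-tuple (setfun R m) -> 'I_m -> R;
  tie : forall i : 'I_n, seed -> k.-tuple (profile R n m) ->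
    i.-tuple (setfun R m) -> {set {set 'I_m}} -> {set 'I_m};
  price_ge0 : forall i w s h j, 0 <= @price i w s h j;
  tie_in : forall i w s h (F : {set {set 'I_m}}),
    F != finset.set0 -> @tie i w s h F \in F;
  measurable_price : forall (i : 'I_n) (j : 'I_m), measurable_fun setT
    (fun x : seed * k.-tuple (profile R n m) * i.-tuple (setfun R m) =>
       @price i x.1.1 x.1.2 x.2 j);
  measurable_tie : forall (i : 'I_n) (F : {set {set 'I_m}}) (B : {set 'I_m}),
    measurable
      [set x : seed * k.-tuple (profile R n m) * i.-tuple (setfun R m) |
         @tie i x.1.1 x.1.2 x.2 F = B]
}.
Arguments price {R n m k} _ i w s h j.
Arguments tie {R n m k} _ i w s h F.

Section run.
Context {R : realType} {n m k : nat} (M : mechanism R n m k).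
Context (w : seed M) (s : k.-tuple (profile R n m)) (v : profile R n m).

Definition history (i : 'I_n) : i.-tuple (setfun R m) :=
  [tuple tnth v (widen_ord (ltnW (ltn_ord i)) j) | j < i].

Definition purchase (i : 'I_n) (U : {set 'I_m}) : {set 'I_m} :=
  tie M i w s (history i)
    (demand (tnth v i) (price M i w s (history i)) U).

(* The items still unsold after the first [t] buyers. *)
Fixpoint unsold (t : nat) : {set 'I_m} :=
  match t with
  | 0 => [set: 'I_m]%SET
  | t'.+1 => if (insub t' : option 'I_n) is Some i
             then (unsold t' :\: purchase i (unsold t'))%SET else unsold t'
  end.

Definition bundle (i : 'I_n) : {set 'I_m} := purchase i (unsold i).

End run.
Arguments purchase {R n m k} M w s v i U.
Arguments unsold {R n m k} M w s v t.
Arguments bundle {R n m k} M w s v i.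

(* The internal randomness, the [k] i.i.d. sample profiles and the actual
   profile are independent. *)
Definition expected_welfare (R : realType) (n m k : nat)
    (M : mechanism R n m k) (D : 'I_n -> probability (setfun R m) R) : \bar R :=
  (\int[(seed_law M \x prod_prob (fun _ : 'I_k => prod_prob D)) \x
        prod_prob D]_x
     (welfare x.2 (bundle M x.1.1 x.1.2 x.2))%:E)%E.

Definition expected_opt (R : realType) (n m : nat)
    (D : 'I_n -> probability (setfun R m) R) : \bar R :=
  (\int[prod_prob D]_v (opt v)%:E)%E.

(* Main.v *)
From HB Require Import structures.
Require Import Defs.
From mathcomp Require Import all_boot all_order all_algebra.
From mathcomp Require Import all_classical all_reals all_analysis.
From mathcomp Require Import measurable_realfun.
From mathcomp Require Import ring lra.

(** If every item is sold with probability close to 1/2 then, whatever the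
    prices are, the revenue and the buyers' utilities together reach almost half
    of the optimum: an item j with price p_j that contributes c_j to the optimum
    yields p_j when it is sold and (c_j - p_j)^+ when it is not.  No price vector
    with this property has to be found.  Averaged over rounds t with prices p^t
    and bits X^t (item sold or not), it suffices that
      sum_t (X^t p^t + (1 - X^t) (c - p^t)^+) >= (1/2 - small) T c
    for every c >= 0, and an online rule achieves this for each item against
    arbitrary bits: it keeps one potential per grid level c and posts the price
    that makes the next increments balance out against the vector of deficits.
    The mechanism simulates T such rounds on T fresh samples and uses the price
    vector of a uniformly random round.  The sample of a round is independent of
    the prices of that round, so it stands for the independent copy of the
    profile that appears in the usual analysis of posted prices.

    The distributions may be heavy-tailed, so the grid is scaled by the total
    value V of N further samples: prices are at most L V, an item is rarely sold
    at a price above V because a fresh profile exceeds V with probability at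
    most 1/N, and the additive error, of order V / K, is negligible because
    E[V] <= N n E[OPT].  When E[OPT] is infinite the same estimate is used on an
    event {V <= Q} of large probability. *)

Set Implicit Arguments.
Unset Strict Implicit.
Unset Printing Implicit Defensive.

Import Order.TTheory GRing.Theory Num.Theory.

Local Open Scope classical_set_scope.
Local Open Scope ring_scope.

(** * The online price rule for one item *)

Section price_rule.
Context {R : realType} (K : nat).
Implicit Types (h : seq bool) (phi : nat -> R) (b : bool) (p l : nat).

(** In grid units, twice the excess of the payoff of a round over half the level [l], where a sale
    is credited with at most [l]. The bit [b] only decides the sign. *)
Definition gain b p l : R := (-1) ^+ (~~ b) * (2 * (minn p l)%:R - l%:R).

Definition deficit phi l : R := Num.max 0 (- phi l).

(** Scalar product of the deficits with the vector of gains after a sale; without a sale the product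
    is the opposite number. A price that makes it small is therefore safe against both bits. *)
Definition imbalance phi p : R :=
  \sum_(l < K.+1) deficit phi l * (2 * (minn p l)%:R - l%:R).

(** If no price below [K] qualifies, [find] returns the length [K] of the list, which does qualify
    because [minn K l = l] at every level. *)
Definition balanced_price phi : nat :=
  find (fun p => 0 <= imbalance phi p) (iota 0 K).

(** Histories list the most recent bit first. The allowance of 2 per round pays for rounding the
    balancing price to an integer. *)
Fixpoint potential h : nat -> R :=
  if h is b :: h'
  then fun l => potential h' l + (gain b (balanced_price (potential h')) l + 2)
  else fun=> 0.

Definition price_rule h : nat := balanced_price (potential h).

Fixpoint rounds_sum (F : bool -> nat -> R) h : R :=
  if h is b :: h' then rounds_sum F h' + F b (price_rule h') else 0.

Lemma deficit_ge0 phi l : 0 <= deficit phi l.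
Proof. by rewrite le_max lexx. Qed.

Lemma balanced_price_le phi : (balanced_price phi <= K)%N.
Proof. by rewrite -[leqRHS](size_iota 0) find_size. Qed.

Lemma imbalance_step phi p :
  imbalance phi p.+1 <=
  imbalance phi p + 2 * \sum_(l < K.+1) deficit phi l.
Proof.
rewrite /imbalance mulr_sumr -big_split /=; apply: ler_sum => l _.
have d0 := deficit_ge0 phi l.
rewrite -subr_ge0 (_ : _ - _ = deficit phi l *
  (2 * ((minn p l)%:R + 1 - (minn p.+1 l)%:R))); last by ring.
rewrite mulr_ge0// mulr_ge0// subr_ge0 natr1 ler_nat.
by rewrite -minnSS leq_min geq_minl geq_min leqnSn orbT.
Qed.

(** A discrete intermediate value argument: the imbalance is at most 0 at price 0, at least 0 at
    price [K], and [imbalance_step] bounds the jump at the first sign change. *)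
Lemma imbalance_balanced phi :
  0 <= imbalance phi (balanced_price phi)
    <= 2 * \sum_(l < K.+1) deficit phi l.
Proof.
have S0 : 0 <= 2 * \sum_(l < K.+1) deficit phi l.
  by rewrite mulr_ge0// sumr_ge0// => l _; exact: deficit_ge0.
have nonneg : 0 <= imbalance phi (balanced_price phi).
  have [hasp|nhas] := boolP (has (fun p => 0 <= imbalance phi p) (iota 0 K)).
    have := nth_find 0%N hasp; rewrite nth_iota ?add0n//.
    by move: hasp; rewrite has_find size_iota.
  rewrite /balanced_price hasNfind// size_iota; apply: sumr_ge0 => l _.
  rewrite mulr_ge0 ?deficit_ge0// (minn_idPr _) ?leq_ord// mulr2n mulrDl mul1r.
  by rewrite addrK.
rewrite nonneg /=; case E : (balanced_price phi) => [|p].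
  apply: le_trans S0; apply: sumr_le0 => l _.
  by rewrite mulr_ge0_le0 ?deficit_ge0// min0n mulr0 sub0r oppr_le0.
apply: le_trans (imbalance_step phi p) _; rewrite gerDr.
have pK : (p < K)%N by rewrite -ltnS -E; exact: balanced_price_le.
have := @before_find _ 0%N (fun p => 0 <= imbalance phi p) (iota 0 K) p.
rewrite -/(balanced_price phi) E ltnSn nth_iota// add0n => /(_ isT) /negbT.
by rewrite -ltNge => /ltW.
Qed.

Lemma gain_norm b p l : `|gain b p l| <= l%:R.
Proof.
rewrite /gain normrM normrX normrN1 expr1n mul1r ler_norml.
have : ((minn p l)%:R <= l%:R :> R) by rewrite ler_nat geq_minr.
have : (0 <= (minn p l)%:R :> R) by [].
by move=> *; apply/andP; split; lra.
Qed.

Lemma sum_deficit_gain phi b :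
  - (2 * \sum_(l < K.+1) deficit phi l) <=
  \sum_(l < K.+1) deficit phi l * gain b (balanced_price phi) l.
Proof.
rewrite (_ : \sum_(l < _) deficit phi l * gain _ _ _ =
  (-1) ^+ (~~ b) * imbalance phi (balanced_price phi)); last first.
  by rewrite /imbalance mulr_sumr; apply: eq_bigr => l _; rewrite /gain; ring.
have /andP[? ?] := imbalance_balanced phi.
by case: b => /=; rewrite ?expr0 ?expr1; lra.
Qed.

(* Blackwell-type argument: the price is chosen so that the next increment of
   the potential makes an almost acute angle with the vector of deficits. *)
Lemma sum_deficit_sqr h :
  \sum_(l < K.+1) deficit (potential h) l ^+ 2 <=
  (size h)%:R * (K.+1 * K.+2 ^ 2)%:R.
Proof.
elim: h => [|b h IH]; first by
  rewrite mul0r big1// => l _; rewrite /deficit /= oppr0 maxxx expr0n.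
set phi := potential h; set p := balanced_price phi.
(* With increment [g], the new deficit is at most the absolute value of the old deficit minus [g].
   The square is expanded, and [g] has absolute value at most [K + 2]. *)
have step (l : 'I_K.+1) : deficit (potential (b :: h)) l ^+ 2 <=
    deficit phi l ^+ 2 - 2 * (deficit phi l * (gain b p l + 2)) + K.+2%:R ^+ 2.
  have /ler_normlP[g1 g2] := gain_norm b p l.
  have lK : (l%:R <= K%:R :> R) by rewrite ler_nat leq_ord.
  have K0 : 0 <= K%:R :> R by [].
  have -> : K.+2%:R = K%:R + 2 :> R by rewrite -natrD addn2.
  rewrite /deficit /= -/phi -/(price_rule h) -/p.
  set x := phi l; set g := gain b p l + 2.
  have gb : g ^+ 2 <= (K%:R + 2) ^+ 2.
    rewrite -subr_ge0 subr_sqr mulr_ge0// /g; lra.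
  have [x0|x0] := lerP 0 (- x); have [y0|y0] := lerP 0 (- (x + g)); nra.
apply: (@le_trans _ _ (\sum_(l < K.+1) (deficit phi l ^+ 2 -
    2 * (deficit phi l * (gain b p l + 2)) + K.+2%:R ^+ 2))).
  by apply: ler_sum => l _; exact: step.
rewrite big_split /= sumr_const card_ord big_split /=.
rewrite (_ : \sum_(i < K.+1) - _ =
  - 2 * (\sum_(l < K.+1) deficit phi l * gain b p l +
         2 * \sum_(l < K.+1) deficit phi l)); last first.
  rewrite mulrDr !mulr_sumr -big_split /=.
  by apply: eq_bigr => l _; ring.
have := sum_deficit_gain phi b; rewrite -/p => ?.
rewrite -/phi in IH; rewrite -[(size h).+1%:R]natr1 mulrDl mul1r.
move: IH; rewrite -(mulr_natl _ K.+1) natrM natrX.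
by move=> IH; lra.
Qed.

Lemma rounds_sumD F G h : rounds_sum (fun b p => F b p + G b p) h =
  rounds_sum F h + rounds_sum G h.
Proof. by elim: h => [|b h /= ->]/=; rewrite ?addr0// addrACA. Qed.

Lemma rounds_sumZ a F h :
  rounds_sum (fun b p => a * F b p) h = a * rounds_sum F h.
Proof. by elim: h => [|b h /= ->]/=; rewrite ?mulr0// mulrDr. Qed.

Lemma rounds_sum_cst a h : rounds_sum (fun _ _ => a) h = (size h)%:R * a.
Proof. by elim: h => [|b h /= ->]/=; rewrite ?mul0r// -natr1 mulrDl mul1r. Qed.

Lemma ler_rounds_sum F G h :
  (forall b p, (p <= K)%N -> F b p <= G b p) ->
  rounds_sum F h <= rounds_sum G h.
Proof.
move=> FG; elim: h => [//|b h IH] /=.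
by rewrite lerD// FG// balanced_price_le.
Qed.

Lemma potentialE h l :
  potential h l = rounds_sum (fun b p => gain b p l) h + 2 * (size h)%:R.
Proof.
elim: h => [|b h IH] /=; first by rewrite mulr0 addr0.
by rewrite IH -natr1 /price_rule; ring.
Qed.

(** The number [T] of rounds is chosen so that the bound of [sum_deficit_sqr] becomes [T ^ 2]. Hence
    no deficit exceeds [T], and removing the allowance of 2 per round costs another [2 T]. *)
Lemma rounds_sum_gain h l : (l <= K)%N -> size h = (K.+1 * K.+2 ^ 2)%N ->
  - (3 * (size h)%:R) <= rounds_sum (fun b p => gain b p l) h.
Proof.
move=> lK hT; have := potentialE h l; set T := (size h)%:R => pE.
have : - T <= potential h l; last by rewrite pE; lra.
have := sum_deficit_sqr h; rewrite -hT -/T.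
rewrite (bigD1 (Ordinal (lK : (l < K.+1)%N)))//= => le1.
have le2 : deficit (potential h) l ^+ 2 <= T ^+ 2.
  rewrite [leRHS]expr2; apply: le_trans le1; rewrite lerDl sumr_ge0// => i _.
  exact: sqr_ge0.
have T0 : 0 <= T by rewrite /T.
have := le2; rewrite ler_pXn2r ?nnegrE ?deficit_ge0// /deficit ge_max.
by move=> /andP[_]; lra.
Qed.

Definition payoff (delta c : R) b p : R :=
  if b then p%:R * delta else Num.max 0 (c - p%:R * delta).

Lemma payoff_gain delta l b p : 0 <= delta ->
  l%:R * delta / 2 + delta / 2 * gain b p l <= payoff delta (l%:R * delta) b p.
Proof.
move=> d0; rewrite /payoff /gain.
have [pl|/ltnW lp] := leqP p l; case: b; rewrite ?expr1 ?expr0.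
- lra.
- by rewrite le_max; apply/orP; right; lra.
- suff : (l%:R * delta <= p%:R * delta) by lra.
  by rewrite ler_wpM2r// ler_nat.
- by rewrite le_max; apply/orP; left; lra.
Qed.

Lemma payoff_mono delta c c' b p : c <= c' ->
  payoff delta c b p <= payoff delta c' b p.
Proof.
move=> cc'; rewrite /payoff; case: b => //.
by rewrite ge_max !le_max lexx/= lerD2r cc' orbT.
Qed.

Lemma rounds_sum_payoff_grid h l delta : 0 <= delta -> (l <= K)%N ->
  size h = (K.+1 * K.+2 ^ 2)%N ->
  (size h)%:R * (l%:R * delta / 2) - 3 / 2 * (size h)%:R * delta <=
  rounds_sum (payoff delta (l%:R * delta)) h.
Proof.
move=> d0 lK hT.
apply: le_trans; last by apply: ler_rounds_sum => b p _; exact: payoff_gain.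
rewrite rounds_sumD rounds_sum_cst rounds_sumZ.
have g := rounds_sum_gain lK hT.
have d20 : 0 <= delta / 2 by rewrite divr_ge0.
have := ler_wpM2l d20 g; lra.
Qed.

(** Below the top level [K * delta], [c] is rounded down to the grid. Above it, every unsold round
    also yields the excess of [c] over the top level, so it must be shown that sales hardly
    outnumber unsold rounds. This follows from the low revenue [rare] and the guarantee at level
    [K], or from [rare0] when the grid is degenerate. *)
Lemma rounds_sum_payoff h delta c e : (0 < K)%N -> 0 <= delta -> 0 <= c ->
  0 <= e ->
  size h = (K.+1 * K.+2 ^ 2)%N ->
  rounds_sum (fun b p => if b then p%:R * delta else 0) h <=
    K%:R * delta * e ->
  (delta = 0 -> rounds_sum (fun b _ => if b then 1 else -1) h <= 2 * e) ->
  (size h)%:R * (c / 2) - 2 * (size h)%:R * delta -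
    c * (3 / 2 * (size h)%:R / K%:R + e) <= rounds_sum (payoff delta c) h.
Proof.
move=> K0 d0 c0 e0 hT rare rare0; set T := (size h)%:R.
have T0 : 0 <= T by rewrite /T.
have K0R : 0 < K%:R :> R by rewrite ltr0n.
have [cB|Bc] := ltrP c (K%:R * delta).
  have dgt0 : 0 < delta.
    by rewrite lt0r d0 andbT; apply: contraTN cB => /eqP->; lra.
  have cd0 : 0 <= c / delta by rewrite divr_ge0.
  (* Rounding [c] down to level [l] loses at most [delta / 2] per round, which turns the grid error
     [3 / 2 * delta] into [2 * delta]. *)
  have /andP[l1 l2] := Num.Theory.truncn_itv cd0; set l := Num.truncn _ in l1 l2.
  have lc : l%:R * delta <= c by rewrite -ler_pdivlMr.
  have cl : c <= l%:R * delta + delta.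
    by rewrite -[X in _ + X]mul1r -mulrDl natr1 -ler_pdivrMr// ltW.
  have lK : (l <= K)%N.
    rewrite -(ler_nat R) -(ler_pM2r dgt0); exact: le_trans lc (ltW cB).
  apply: le_trans; last first.
    by apply: ler_rounds_sum => b p _; exact: (payoff_mono _ _ _ lc).
  apply: le_trans (rounds_sum_payoff_grid d0 lK hT); rewrite -/T.
  have : 0 <= c * (3 / 2 * T / K%:R + e).
    by rewrite mulr_ge0// addr_ge0// divr_ge0// mulr_ge0.
  nra.
(* Sales minus unsold rounds, so [(T - S) / 2] rounds are unsold. *)
set S := rounds_sum (fun b _ => if b then 1 else -1) h.
have payE : rounds_sum (payoff delta c) h =
    rounds_sum (payoff delta (K%:R * delta)) h +
    (c - K%:R * delta) / 2 * (T - S).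
  rewrite mulrBr (mulrC _ T) -rounds_sum_cst -rounds_sumZ -mulN1r.
  rewrite -rounds_sumZ -!rounds_sumD.
  apply/eqP; rewrite eq_le; apply/andP; split; apply: ler_rounds_sum => b p pK;
    rewrite /payoff; case: b; try lra;
  (have pB : p%:R * delta <= K%:R * delta by rewrite ler_wpM2r// ler_nat);
  by rewrite !max_r; lra.
have SB : K%:R * S <= 3 * T + 2 * K%:R * e.
  have [deq0|dn0] := eqVneq delta 0.
    have := rare0 deq0; rewrite -/S; nra.
  have dgt0 : 0 < delta by rewrite lt0r dn0.
  have gK := rounds_sum_gain (leqnn K) hT.
  (* At the top level a sale gains [2 p - K] and an unsold round at most [K], so many sales with
     little revenue would contradict [gK]. *)
  have : delta * rounds_sum (fun b p => gain b p K) h <=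
      - (K%:R * delta * S) +
      2 * rounds_sum (fun b p => if b then p%:R * delta else 0) h.
    rewrite -mulNr -!rounds_sumZ -rounds_sumD; apply: ler_rounds_sum => b p pK.
    rewrite /gain (minn_idPl pK); case: b; rewrite ?expr1 ?expr0.
      lra.
    have : 0 <= p%:R * delta by rewrite mulr_ge0.
    lra.
  rewrite -/T in gK; move=> le1.
  rewrite -(ler_pM2l dgt0); nra.
have := rounds_sum_payoff_grid d0 (leqnn K) hT; rewrite -/T payE => grid.
have SB' : S <= 3 * T / K%:R + 2 * e.
  rewrite -(ler_pM2l K0R) mulrDr mulrCA divff ?mulr1 ?gt_eqF//.
  lra.
have Td : 0 <= T * delta by rewrite mulr_ge0.
have Q0 : 0 <= 3 / 2 * T / K%:R + e.
  by rewrite addr_ge0// divr_ge0// mulr_ge0.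
set Q := 3 / 2 * T / K%:R + e in Q0 *.
have SQ : S <= 2 * Q by rewrite /Q; lra.
have Kd0 : 0 <= K%:R * delta by rewrite mulr_ge0.
have : (c - K%:R * delta) / 2 * S <= c * Q.
  apply: (@le_trans _ _ ((c - K%:R * delta) / 2 * (2 * Q))).
    by apply: ler_wpM2l => //; lra.
  nra.
lra.
Qed.

End price_rule.

(** * Posted prices and XOS valuations *)

Section posted_prices.
Context {R : realType} {n m : nat}.
Implicit Types (v : setfun R m) (x : profile R n m) (p : 'I_m -> R).
Implicit Types (U B S : {set 'I_m}) (F : {set {set 'I_m}}).

Definition tie_empty F : {set 'I_m} :=
  if finset.set0 \in F then finset.set0 else odflt finset.set0 [pick B in F].

Lemma tie_empty_in F : F != finset.set0 -> tie_empty F \in F.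
Proof.
rewrite /tie_empty; case: ifPn => // _ /set0Pn[B BF].
by case: pickP => [//|/(_ B)]; rewrite BF.
Qed.

Definition buy v p U : {set 'I_m} := tie_empty (demand v p U).

Fixpoint remaining p x (t : nat) : {set 'I_m} :=
  if t is t'.+1 then
    if insub t' is Some i
    then (remaining p x t' :\: buy (tnth x i) p (remaining p x t'))%SET
    else remaining p x t'
  else [set: 'I_m]%SET.

Definition max_utility v p U : R :=
  \big[Num.max/0]_(B : {set 'I_m} | B \subset U) utility v p B.

(** The absolute values make this nonnegative on all tuples of set functions, not only on
    valuations, since the integrals range over all of them. *)
Definition total_value x : R := \sum_i `|value (tnth x i) [set: 'I_m]%SET|.

Lemma utility_set0 v p : value v finset.set0 = 0 -> utility v p finset.set0 = 0.
Proof. by move=> v0; rewrite /utility v0 big_set0 subr0. Qed.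

Lemma demand_neq0 v p U : demand v p U != finset.set0.
Proof.
have := @arg_maxP _ _ _ finset.set0 (fun B : {set 'I_m} => B \subset U)
  (utility v p) (finset.sub0set U).
case=> B BU Bmax.
apply/set0Pn; exists B; rewrite inE BU; apply/forallP => C.
by apply/implyP=> /Bmax.
Qed.

Lemma buy_demand v p U : buy v p U \in demand v p U.
Proof. exact/tie_empty_in/demand_neq0. Qed.

Lemma buy_sub v p U : buy v p U \subset U.
Proof. by have := buy_demand v p U; rewrite inE => /andP[]. Qed.

Lemma le_max_utility v p U B : B \subset U -> utility v p B <= max_utility v p U.
Proof. by move=> BU; exact: (le_bigmax_cond _ (utility v p)). Qed.

Lemma max_utility_ge0 v p U : 0 <= max_utility v p U.
Proof. exact: bigmax_ge_id. Qed.

Lemma max_utility_mono v p U U' : U \subset U' ->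
  max_utility v p U <= max_utility v p U'.
Proof.
move=> UU'; apply: bigmax_le => [|B BU]; first exact: max_utility_ge0.
exact/le_max_utility/(fintype.subset_trans BU).
Qed.

Lemma utility_buy v p U : value v finset.set0 = 0 ->
  utility v p (buy v p U) = max_utility v p U.
Proof.
move=> v0; have := buy_demand v p U; rewrite inE => /andP[BU /forallP Bmax].
apply/eqP; rewrite eq_le le_max_utility//=; apply: bigmax_le => [|C CU].
  rewrite -(utility_set0 p v0).
  by have /implyP := Bmax finset.set0; apply; rewrite finset.sub0set.
by have /implyP := Bmax C; apply.
Qed.

(* Ties are broken in favour of the empty set, so a sale needs a positive
   utility. *)
Lemma buy_gt0 v p U : value v finset.set0 = 0 -> buy v p U != finset.set0 ->
  0 < utility v p (buy v p U).
Proof.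
move=> v0 B0; rewrite utility_buy// lt0r max_utility_ge0 andbT.
apply: contra_neq B0 => u0; rewrite /buy /tie_empty ifT//.
rewrite inE finset.sub0set/=; apply/forallP => C; apply/implyP => CU.
by rewrite utility_set0// -u0 le_max_utility.
Qed.

Lemma remaining_mono p x s t : (s <= t)%N ->
  remaining p x t \subset remaining p x s.
Proof.
move=> /subnK <-; elim: (t - s)%N => [//|d IH]; rewrite addSn /=.
case: insub => [i|//]; exact: fintype.subset_trans (finset.subsetDl _ _) IH.
Qed.

Lemma remainingS p x (i : 'I_n) : remaining p x i.+1 =
  (remaining p x i :\: buy (tnth x i) p (remaining p x i))%SET.
Proof. by rewrite /=; case: insubP => [j _ /val_inj->//|]; rewrite ltn_ord. Qed.

Lemma eq_remaining p x x' (t : nat) :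
  (forall i : 'I_n, (i < t)%N -> tnth x i = tnth x' i) ->
  remaining p x t = remaining p x' t.
Proof.
elim: t => [//|t IH] xx' /=; rewrite IH => [|i it]; last first.
  by apply: xx'; rewrite ltnS ltnW.
by case: insubP => // i _ it; rewrite xx'// it.
Qed.

Lemma sum_sold p x (t : nat) : (t <= n)%N ->
  \sum_(j in ~: remaining p x t) p j =
  \sum_(i < n | (i < t)%N) \sum_(j in buy (tnth x i) p (remaining p x i)) p j.
Proof.
elim: t => [_|t IH tn].
  by rewrite /= finset.setCT big_set0 big_pred0.
rewrite (remainingS p x (Ordinal tn)) (bigD1 (Ordinal tn))//= finset.setCD.
set B := buy _ _ _; set Z := remaining p x t.
rewrite (eq_bigl [in [predU B & ~: Z]]%SET) => [|j]; last by rewrite !inE orbC.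
rewrite bigU /=; last first.
  by rewrite finset.disjoints_subset finset.setCK; exact: buy_sub.
rewrite IH ?(ltnW tn)//; congr (_ + _); apply: eq_bigl => i.
by rewrite ltnS -val_eqE/= ltn_neqAle andbC.
Qed.

(** A value is a utility plus a payment, and the payments add up to the prices of the sold items. *)
Lemma welfare_posted p x : (forall i, value (tnth x i) finset.set0 = 0) ->
  welfare x (fun i => buy (tnth x i) p (remaining p x i)) =
  \sum_(j in ~: remaining p x n) p j +
  \sum_i max_utility (tnth x i) p (remaining p x i).
Proof.
move=> x0; rewrite sum_sold// [X in X + _](_ : _ = \sum_(i < n)
   \sum_(j in buy (tnth x i) p (remaining p x i)) p j); last first.
  by apply: eq_bigl => i; rewrite ltn_ord.
rewrite -big_split; apply: eq_bigr => i _ /=.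
by rewrite -utility_buy// /utility addrC subrK.
Qed.

(** The buyer of [j] has positive utility, hence values the bundle above its total price. The strict
    inequality matters when all prices are 0. *)
Lemma sold_lt_total p x j : (forall i, valuation (tnth x i)) ->
  (forall k, 0 <= p k) -> j \notin remaining p x n -> p j < total_value x.
Proof.
move=> vx p0 jn.
have [i ji] : exists i : 'I_n, j \in buy (tnth x i) p (remaining p x i).
  apply/existsP; apply: contraR jn; rewrite negb_exists => /forallP jB.
  have : forall t, (t <= n)%N -> j \in remaining p x t; last exact.
  elim=> [|t IH tn]; first by rewrite inE.
  by rewrite (remainingS p x (Ordinal tn)) inE IH ?(ltnW tn)// andbT jB.
have [v0 vs0 vmono] := vx i.
have : 0 < utility (tnth x i) p (buy (tnth x i) p (remaining p x i)).
  by apply: buy_gt0 => //; apply/set0Pn; exists j.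
rewrite /utility (bigD1 j)//= subr_gt0 => lt1.
apply: (@lt_le_trans _ _ (value (tnth x i) [set: 'I_m]%SET)).
  apply: lt_le_trans (vmono _ _ (finset.subsetT _)).
  by apply: le_lt_trans lt1; rewrite lerDl sumr_ge0.
by rewrite /total_value (bigD1 i)//= -[leLHS]addr0 lerD ?ler_norm// sumr_ge0.
Qed.

Lemma opt_ge0 x : 0 <= opt x.
Proof. exact: bigmax_ge_id. Qed.

Lemma value_le_opt x i : (forall i, valuation (tnth x i)) ->
  value (tnth x i) [set: 'I_m]%SET <= opt x.
Proof.
move=> vx; set A := [ffun k => if k == i then [set: 'I_m]%SET else finset.set0].
have AA : allocation A.
  apply/forallP => k; apply/forallP => l; apply/implyP => kl; rewrite !ffunE.
  case: eqP => [ki|_]; last by rewrite finset.disjoints_subset finset.sub0set.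
  rewrite -ki eq_sym (negbTE kl) disjoint_sym finset.disjoints_subset.
  exact: finset.sub0set.
apply: (@le_trans _ _ (welfare x A)); last first.
  by rewrite /opt (bigmaxD1 A)//= le_max lexx.
rewrite /welfare (bigD1 i)//= ffunE eqxx lerDl sumr_ge0// => k _.
by have [] := vx k.
Qed.

Lemma total_value_le x : (forall i, valuation (tnth x i)) ->
  total_value x <= n%:R * opt x.
Proof.
move=> vx; rewrite (_ : _ * _ = \sum_(i < n) opt x); last first.
  by rewrite sumr_const card_ord mulr_natl.
apply: ler_sum => i _; rewrite ger0_norm ?value_le_opt//.
by have [] := vx i.
Qed.

(** The supporting function is a clause that attains the maximum at [B]. *)
Lemma xos_supporting v B : xos v -> exists a : 'I_m -> R,
  [/\ forall j, 0 <= a j, value v B = \sum_(j in B) a j &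
      forall S, \sum_(j in S) a j <= value v S].
Proof.
move=> [_ [L [a [a0 aE]]]].
have [l _ lB] : exists2 l, l \in 'I_L.+1 & value v B = \sum_(j in B) a l j.
  rewrite aE; have [//|l _|l lI ->] := @eq_bigmax _ _ _ 0 ord0 xpredT
    (fun l => \sum_(j in B) a l j); first by rewrite sumr_ge0.
  by exists l.
exists (a l); split=> // S; rewrite aE.
exact: (le_bigmax _ (fun l => \sum_(j in S) a l j)).
Qed.

(** In an optimal allocation, [c j] is the weight of [j] in the clause supporting the bundle that
    contains [j]. The weights do not depend on [p] or [U], so the same [c] serves in all rounds. *)
Lemma opt_supporting x : (forall i, xos (tnth x i)) ->
  exists c : 'I_m -> R, [/\ forall j, 0 <= c j, \sum_j c j = opt x &
    forall p U, (forall j, 0 <= p j) ->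
      \sum_(j in U) Num.max 0 (c j - p j) <=
      \sum_i max_utility (tnth x i) p U].
Proof.
move=> xx.
have [A AA ->] : exists2 A : {ffun 'I_n -> {set 'I_m}}, allocation A &
    opt x = welfare x A.
  have A0 : allocation ([ffun=> finset.set0] : {ffun 'I_n -> {set 'I_m}}).
    apply/forallP => k; apply/forallP => l; apply/implyP => _; rewrite !ffunE.
    by rewrite finset.disjoints_subset finset.sub0set.
  have [A _|A AA AE] := @eq_bigmax _ _ _ 0 _
      (fun A : {ffun 'I_n -> {set 'I_m}} => allocation A)
      (fun A : {ffun 'I_n -> {set 'I_m}} => welfare x A) A0.
    by apply: sumr_ge0 => i _; have [[]] := xx i.
  by exists A.
have /choice[a aP] i := xos_supporting (A i) (xx i).
have mem_eq i i' j : j \in A i -> j \in A i' -> i = i'.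
  move=> ji ji'; apply/eqP; apply: contraT => ii'.
  have /forallP/(_ i)/forallP/(_ i')/implyP/(_ ii') := AA.
  by move=> /pred0P/(_ j) /=; rewrite ji ji'.
exists (fun j => \sum_(i | j \in A i) a i j); split.
- by move=> j; apply: sumr_ge0 => i _; have [] := aP i.
- rewrite (exchange_big_dep xpredT)//=; apply: eq_bigr => i _.
  by have [_ -> _] := aP i.
move=> p U p0.
apply: (@le_trans _ _ (\sum_(j in U) \sum_(i | j \in A i)
   Num.max 0 (a i j - p j))).
  apply: ler_sum => j _.
  have [i ji|jA] := pickP (fun i => j \in A i); last first.
    by rewrite !big_pred0// sub0r ge_max lexx/= oppr_le0.
  have only i' : (j \in A i') = (i' == i).
    by apply/idP/eqP => [/(mem_eq _ _ _ ji)|->].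
  by rewrite (eq_bigl _ _ only) (eq_bigl _ _ only) !big_pred1_eq.
rewrite (exchange_big_dep xpredT)//=; apply: ler_sum => i _.
have [a0 _ aS] := aP i.
(* Buyer [i] could take the items of [A i] in [U] whose weight exceeds their price; the clause
   bounds the value of this set from below. *)
pose B := [set j in U | (j \in A i) && (p j < a i j)]%SET.
apply: (@le_trans _ _ (utility (tnth x i) p B)); last first.
  by apply: le_max_utility; apply/fintype.subsetP => j; rewrite inE => /andP[].
apply: (@le_trans _ _ (\sum_(j in B) (a i j - p j))).
  rewrite big_mkcond [leRHS]big_mkcond; apply: ler_sum => j _; rewrite inE.
  case: (j \in U) => //=; case: (j \in A i) => //=; case: ltrP => pa.
    by rewrite ge_max subr_ge0 (ltW pa) lexx.
  by rewrite ge_max lexx subr_le0.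
by rewrite sumrB /utility lerD2r.
Qed.

End posted_prices.

(** * Product measures and measurability *)

Lemma measurable_integral {R : realType} d1 d2 (T1 : measurableType d1)
    (T2 : measurableType d2) (mu : probability T2 R) (f : T1 -> T2 -> \bar R) :
  measurable_fun setT (fun z : T1 * T2 => f z.1 z.2) ->
  (forall x y, 0 <= f x y)%E ->
  measurable_fun setT (fun x => \int[mu]_y f x y)%E.
Proof. by move=> mf f0; apply: (measurable_fun_fubini_tonelli_F _ mf) => z. Qed.

Lemma integral_probability_cst {R : realType} d (T : measurableType d)
  (P : probability T R) (c : \bar R) : (\int[P]_x c = c)%E.
Proof. by rewrite integral_cst//= probability_setT mule1. Qed.

Section resampling.
Context {R : realType} {d : measure_display} {T : measurableType d}.

Definition replace n (i : 'I_n) (t : n.-tuple T) (x : T) : n.-tuple T :=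
  [tuple if j == i then x else tnth t j | j < n].

Lemma tnth_replace n (i j : 'I_n) (t : n.-tuple T) x :
  tnth (replace i t x) j = if j == i then x else tnth t j.
Proof. by rewrite tnth_mktuple. Qed.

Lemma replace_ord0 n (t : n.-tuple T) (x y : T) :
  replace ord0 [tuple of x :: t] y = [tuple of y :: t].
Proof.
apply: eq_from_tnth => j; rewrite tnth_replace.
by case: (unliftP ord0 j) => [k ->|->//]; rewrite !tnthS.
Qed.

Lemma replace_lift n (i : 'I_n) (t : n.-tuple T) (x y : T) :
  replace (lift ord0 i) [tuple of x :: t] y = [tuple of x :: replace i t y].
Proof.
apply: eq_from_tnth => j; rewrite tnth_replace.
case: (unliftP ord0 j) => [k ->|->//]; rewrite !tnthS tnth_replace.
by rewrite (inj_eq lift_inj).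
Qed.

Lemma measurable_replace n (i : 'I_n) :
  measurable_fun setT (fun z : n.-tuple T * T => replace i z.1 z.2).
Proof.
apply/measurable_fun_tnthP => j /=.
have -> : (tnth (T:=T))^~ j \o (fun z : n.-tuple T * T => replace i z.1 z.2) =
   fun z => if j == i then z.2 else tnth z.1 j.
  by apply/funext => z /=; rewrite tnth_replace.
case: (j == i); first exact: measurable_snd.
exact: (measurableT_comp (measurable_tnth j) measurable_fst).
Qed.

Lemma ge0_integral_prod_probS n (D : 'I_n.+1 -> probability T R)
    (f : n.+1.-tuple T -> \bar R) : measurable_fun setT f ->
  (forall t, 0 <= f t)%E ->
  (\int[prod_prob D]_t f t =
   \int[D ord0]_x \int[prod_prob (fun i => D (lift ord0 i))]_t
     f [tuple of x :: t])%E.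
Proof.
move=> mf f0 /=; rewrite ge0_integral_distribution//.
rewrite fubini_tonelli1//; last by move=> z; exact: f0.
by apply: measurableT_comp => //; exact: measurable_consT.
Qed.

(** Coordinate [i] is independent of the others, so a fresh draw in its place leaves the law
    unchanged. *)
Lemma ge0_integral_replace n (D : 'I_n -> probability T R) (i : 'I_n)
    (f : n.-tuple T -> \bar R) : measurable_fun setT f ->
  (forall t, 0 <= f t)%E ->
  (\int[prod_prob D]_t f t =
   \int[prod_prob D]_t \int[D i]_x f (replace i t x))%E.
Proof.
elim: n D i f => [D []//|n IH] D i f mf f0.
have mfr (j : 'I_n.+1) : measurable_fun setT (fun z : n.+1.-tuple T * T =>
    f (replace j z.1 z.2)).
  by apply: measurableT_comp => //; exact: measurable_replace.
rewrite ge0_integral_prod_probS// [RHS]ge0_integral_prod_probS//; first last.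
- by move=> t; exact: integral_ge0.
- exact: measurable_integral.
have mfc (x : T) : measurable_fun setT (fun t : n.-tuple T =>
    f [tuple of x :: t]).
  apply: measurableT_comp => //.
  exact: measurable_cons.
case: (unliftP ord0 i) => [j ->|->].
  apply: eq_integral => x _; rewrite (IH _ j)//.
  by apply: eq_integral => t _; apply: eq_integral => y _; rewrite replace_lift.
under [in RHS]eq_integral do under eq_integral do
  under eq_integral do rewrite replace_ord0.
rewrite [RHS]integral_probability_cst.
rewrite (fubini_tonelli (fun z : T * n.-tuple T => f [tuple of z.1 :: z.2]))//.
by apply: measurableT_comp => //; exact: measurable_consT.
Qed.

Lemma ge0_integral_tnth n (D : 'I_n -> probability T R) (i : 'I_n)
    (f : T -> \bar R) : measurable_fun setT f -> (forall x, 0 <= f x)%E ->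
  (\int[prod_prob D]_t f (tnth t i) = \int[D i]_x f x)%E.
Proof.
move=> mf f0; rewrite (ge0_integral_replace D i)//; last first.
  by apply: measurableT_comp => //; exact: measurable_tnth.
under eq_integral do under eq_integral do rewrite tnth_replace eqxx.
exact: integral_probability_cst.
Qed.

(** A coordinate and a fresh draw of the same law are exchangeable: redrawing coordinate [i] on both
    sides leaves two draws in opposite orders, which Tonelli's theorem interchanges. *)
Lemma ge0_integral_swap n (D : 'I_n -> probability T R) (i : 'I_n)
    (f : n.-tuple T * T -> \bar R) :
  measurable_fun setT f -> (forall z, 0 <= f z)%E ->
  (\int[prod_prob D]_t \int[D i]_x f (t, x) =
   \int[prod_prob D]_t \int[D i]_x f (replace i t x, tnth t i))%E.
Proof.
move=> mf f0.
have mg : measurable_fun setT (fun z : n.-tuple T * T =>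
    f (replace i z.1 z.2, tnth z.1 i)).
  apply: measurableT_comp => //; apply: measurable_fun_pair => //.
    exact: measurable_replace.
  exact: (measurableT_comp (measurable_tnth i) measurable_fst).
rewrite [RHS](ge0_integral_replace D i); first last.
- by move=> t; exact: integral_ge0.
- by apply: measurable_integral.
have E t y x : f (replace i (replace i t y) x, tnth (replace i t y) i) =
    f (replace i t x, y).
  rewrite tnth_replace eqxx; congr (f (_, _)); apply: eq_from_tnth => j.
  by rewrite !tnth_replace; case: (j == i).
under [RHS]eq_integral do under eq_integral do
  under eq_integral do rewrite E.
rewrite [LHS](ge0_integral_replace D i); first last.
- by move=> t; exact: integral_ge0.
- apply: measurable_integral => //.
  by apply: measurableT_comp => //; apply: measurable_fun_pair;
    [exact: measurable_fst|exact: measurable_snd].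
apply: eq_integral => t _.
rewrite (fubini_tonelli (fun z : T * T => f (replace i t z.1, z.2)))//.
apply: measurableT_comp => //; apply: measurable_fun_pair; last exact: measurable_snd.
have mt : measurable_fun setT (fun z : T * T => (t, z.1)).
  by apply: measurable_fun_pair => //; exact: measurable_fst.
exact: (measurableT_comp (measurable_replace i) mt).
Qed.

(** Outside measurable null sets [N i] the condition holds on a box, which has measure 1 by
    [prod_probE]. *)
Lemma ae_prod_prob n (D : 'I_n -> probability T R) (P : 'I_n -> T -> Prop) :
  (forall i, {ae D i, forall x, P i x}) ->
  {ae prod_prob D, forall t, forall i, P i (tnth t i)}.
Proof.
move=> aeP.
have /choice[N NP] (i : 'I_n) : exists N : set T,
    [/\ measurable N, D i N = 0%E & ~` P i `<=` N].
  by have [N [mN N0 PN]] := aeP i; exists N.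
have mC : measurable [set t : n.-tuple T | forall i, (~` N i) (tnth t i)].
  apply: (measurable_tuple_rect (A := fun i => ~` N i)) => i.
  by apply: measurableC; have [] := NP i.
exists (~` [set t | forall i, (~` N i) (tnth t i)]); split.
- exact: measurableC.
- rewrite probability_setC// (prod_probE _ (A := fun i => ~` N i)) => [|i]; last first.
    by apply: measurableC; have [] := NP i.
  rewrite big1 ?subee// => i _; have [mN N0 _] := NP i.
  by rewrite probability_setC// N0 sube0.
- apply: subsetC => t /= Nt i; apply: contrapT => nP.
  by have [_ _ /(_ _ nP)] := NP i; exact: Nt.
Qed.

End resampling.

(** * Measurability of maps with countably many values *)

Section levels.
Context {d : measure_display} {Omega : measurableType d}.

(** Discrete measurability, for values such as sets of items and histories, which are given no
    sigma-algebra here. *)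
Definition measurable_levels (A : Type) (F : Omega -> A) : Prop :=
  forall a, measurable [set w | F w = a].

(** The space splits into the countably many fibres of [F], and on each of them a single [G a]
    occurs. *)
Lemma measurable_levels_dep (A : countType) (B : Type) (F : Omega -> A)
    (G : A -> Omega -> B) : measurable_levels F ->
  (forall a, measurable_levels (G a)) -> measurable_levels (fun w => G (F w) w).
Proof.
move=> mF mG b; rewrite (_ : [set w | _] =
  \bigcup_a ([set w | F w = a] `&` [set w | G a w = b])).
  apply: countable_bigcupT_measurable => [|a]; first exact: countableP.
  by apply: measurableI; [exact: mF|exact: mG].
by apply/seteqP; split => w /=; [move=> <-; exists (F w)|case=> a _ [->]].
Qed.

Lemma measurable_levels_cst (A : Type) (a : A) :
  measurable_levels (fun=> a).
Proof.
move=> b; have [->|ab] := pselect (a = b).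
  by rewrite (_ : [set _ | _] = setT) //; apply/seteqP.
by rewrite (_ : [set _ | _] = set0) //; apply/seteqP; split.
Qed.

Lemma measurable_levels_comp (A : countType) (B : Type) (h : A -> B)
    (F : Omega -> A) : measurable_levels F -> measurable_levels (h \o F).
Proof.
move=> mF; apply: (measurable_levels_dep (G := fun a _ => h a)) => // a.
exact: measurable_levels_cst.
Qed.

Lemma measurable_levels_fun d' (A : countType) (B : measurableType d')
    (F : Omega -> A) (G : A -> Omega -> B) : measurable_levels F ->
  (forall a, measurable_fun setT (G a)) ->
  measurable_fun setT (fun w => G (F w) w).
Proof.
move=> mF mG _ Y mY; rewrite setTI (_ : _ @^-1` _ =
  \bigcup_a ([set w | F w = a] `&` (G a @^-1` Y))).
  apply: countable_bigcupT_measurable => [|a]; first exact: countableP.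
  apply: measurableI => //.
  by rewrite -[X in measurable X]setTI; exact: mG.
by apply/seteqP; split => w /=; [move=> ?; exists (F w)|case=> a _ [->]].
Qed.

Lemma measurable_levels_ffun (I : finType) (A : Type)
    (F : I -> Omega -> A) : (forall i, measurable_levels (F i)) ->
  measurable_levels (fun w => [ffun i => F i w]).
Proof.
move=> mF f; rewrite (_ : [set w | _] =
  \bigcap_(i in [set: I]) [set w | F i w = f i]).
  by apply: fin_bigcap_measurable => // i _; exact: mF.
apply/seteqP; split => w /= => [<- i _|Fw]; first by rewrite ffunE.
by apply/ffunP => i; rewrite ffunE; exact: Fw.
Qed.

Lemma measurable_levels_bool (F : Omega -> bool) :
  measurable_fun setT F -> measurable_levels F.
Proof.
move=> mF b; rewrite -[X in measurable X]setTI.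
exact: (mF measurableT [set b]).
Qed.

End levels.

(** * Simulated rounds *)

Section simulation.
Context {R : realType} {n m : nat} (K : nat).
Implicit Types (x y : profile R n m) (p : 'I_m -> R) (h : seq {set 'I_m}).
Implicit Types (xs : nat -> profile R n m).

Definition sold_bits h (j : 'I_m) : seq bool := [seq j \in B | B : {set _} <- h].

Definition posted (delta : R) h (j : 'I_m) : R :=
  (@price_rule R K (sold_bits h j))%:R * delta.

(* The sets sold in the simulated rounds, most recent first. *)
Fixpoint sold_sets (delta : R) xs (t : nat) : seq {set 'I_m} :=
  if t is t'.+1
  then (~: remaining (posted delta (sold_sets delta xs t')) (xs t') n)%SET
       :: sold_sets delta xs t'
  else [::].

(** All buyers of [x] face the same leftover set, produced by another profile [y]. This form matches
    the per-item payoffs, and for independent [x] and [y] it is a lower estimate of the welfare in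
    expectation ([ghost_le_posted]). *)
Definition ghost_welfare p x y : R :=
  \sum_(j in ~: remaining p y n) p j +
  \sum_i max_utility (tnth x i) p (remaining p y n).

Lemma posted_ge0 delta h j : 0 <= delta -> 0 <= posted delta h j.
Proof. by move=> d0; rewrite mulr_ge0. Qed.

Lemma size_sold_sets delta xs t : size (sold_sets delta xs t) = t.
Proof. by elim: t => //= t ->. Qed.

Lemma eq_sold_sets delta xs xs' t : (forall s, (s < t)%N -> xs s = xs' s) ->
  sold_sets delta xs t = sold_sets delta xs' t.
Proof.
elim: t => [//|t IH] xx' /=; rewrite IH ?xx'// => s st.
by rewrite xx'// ltnS ltnW.
Qed.

Lemma rounds_sum_sold_sets (F : bool -> nat -> R) delta xs t j :
  rounds_sum K F (sold_bits (sold_sets delta xs t) j) =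
  \sum_(s < t) F (j \notin remaining (posted delta (sold_sets delta xs s))
                     (xs s) n)
    (@price_rule R K (sold_bits (sold_sets delta xs s) j)).
Proof.
elim: t => [|t IH]; first by rewrite big_ord0.
by rewrite big_ord_recr /= IH finset.in_setC.
Qed.

Lemma sum_payoff_le_ghost_welfare delta h x y (c : 'I_m -> R) : 0 <= delta ->
  (forall p (U : {set 'I_m}), (forall j, 0 <= p j) ->
     \sum_(j in U) Num.max 0 (c j - p j) <=
     \sum_i max_utility (tnth x i) p U) ->
  \sum_j payoff delta (c j) (j \notin remaining (posted delta h) y n)
    (@price_rule R K (sold_bits h j)) <=
  ghost_welfare (posted delta h) x y.
Proof.
move=> d0 cP; set U := remaining _ _ _.
rewrite (bigID (mem (~: U)%SET))/= lerD//.
  by apply: ler_sum => j; rewrite finset.in_setC /payoff => ->.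
apply: le_trans (cP _ U (fun j => posted_ge0 h j d0)).
rewrite (eq_bigl [in U]) => [|j]; last by rewrite finset.in_setC negbK.
by apply: ler_sum => j jU; rewrite /payoff jU.
Qed.

(** No probability enters: the online rule is applied to each item with the weight [c j] from an
    optimum of [x], against whatever bits [xs] produces, and the results are added over the
    items. *)
Lemma sum_ghost_welfare_ge (L T : nat) (V delta : R) x xs : (0 < K)%N ->
  (0 < L)%N -> T = (K.+1 * K.+2 ^ 2)%N -> 0 <= V ->
  delta = L%:R * V / K%:R ->
  (forall i, xos (tnth x i)) ->
  (forall t i, (t < T)%N -> valuation (tnth (xs t) i)) ->
  opt x * (T%:R * (1 / 2 - 3 / 2 / K%:R - 1 / L%:R) -
           \sum_(t < T) (V < total_value (xs t))%R%:R) -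
    2 * m%:R * T%:R * delta <=
  \sum_(t < T) ghost_welfare (posted delta (sold_sets delta xs t)) x (xs t).
Proof.
move=> K0 L0 TE V0 deltaE xx vxs.
have K0R : 0 < K%:R :> R by rewrite ltr0n.
have L0R : 0 < L%:R :> R by rewrite ltr0n.
have d0 : 0 <= delta by rewrite deltaE divr_ge0// mulr_ge0.
have [c [c0 cE cP]] := opt_supporting xx.
set r := \sum_(t < T) _%:R.
have r0 : 0 <= r by exact: sumr_ge0.
apply: (@le_trans _ _ (\sum_j rounds_sum K (payoff delta (c j))
    (sold_bits (sold_sets delta xs T) j))); last first.
  under eq_bigr do rewrite rounds_sum_sold_sets.
  rewrite exchange_big /=; apply: ler_sum => t _.
  exact: sum_payoff_le_ghost_welfare.
have Kd : K%:R * delta = L%:R * V.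
  by rewrite deltaE mulrC divfK// gt_eqF.
have sold_rare (t : 'I_T) j :
    j \notin remaining (posted delta (sold_sets delta xs t)) (xs t) n ->
    V <= posted delta (sold_sets delta xs t) j -> V < total_value (xs t).
  move=> jn; move/le_lt_trans; apply; apply: sold_lt_total => //.
  - by move=> i; exact: vxs.
  - by move=> k; exact: posted_ge0.
have item j : T%:R * (c j / 2) - 2 * T%:R * delta -
    c j * (3 / 2 * T%:R / K%:R + (T%:R / L%:R + r)) <=
    rounds_sum K (payoff delta (c j))
      (sold_bits (sold_sets delta xs T) j).
  have TE' : size (sold_bits (sold_sets delta xs T) j) = T.
    by rewrite size_map size_sold_sets.
  have := @rounds_sum_payoff R K (sold_bits (sold_sets delta xs T) j)
    delta (c j) (T%:R / L%:R + r) K0 d0 (c0 j).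
  rewrite TE'; apply => //.
  - by rewrite addr_ge0// divr_ge0.
  (* A sale below [V] brings at most [V = K * delta / L], which accounts for [T / L]. A sale at [V]
     or more brings at most [K * delta] and occurs only in rounds counted by [r]. *)
  - rewrite rounds_sum_sold_sets Kd mulrDr mulrAC mulrCA divff ?gt_eqF// mulr1.
    rewrite (_ : T%:R * V = \sum_(t < T) V); last first.
      by rewrite sumr_const card_ord mulr_natl.
    rewrite mulr_sumr -big_split; apply: ler_sum => t _ /=.
    have LV : 0 <= L%:R * V by rewrite mulr_ge0.
    case: ifPn => [jn|_]; last by rewrite addr_ge0// mulr_ge0.
    have := sold_rare t j jn; rewrite -/(posted _ _ _).
    set p := posted _ _ _; have [pV _|Vp /(_ isT) ->] := ltrP p V.
      by apply: (le_trans (ltW pV)); rewrite lerDl mulr_ge0.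
    rewrite mulr1 -Kd; apply: (@le_trans _ _ (K%:R * delta)); last by rewrite lerDr.
    by rewrite ler_wpM2r// ler_nat balanced_price_le.
  (* When the grid step is 0, so are [V] and all prices, and every round with a sale is counted by
     [r]. *)
  - move=> deq0; have Veq0 : V = 0.
      move: Kd; rewrite deq0 mulr0 => /esym/eqP.
      by rewrite mulf_eq0 gt_eqF//= => /eqP.
    rewrite rounds_sum_sold_sets; apply: (@le_trans _ _ r); last first.
      by have : 0 <= T%:R / L%:R :> R; [rewrite divr_ge0|lra].
    apply: ler_sum => t _; case: ifPn => [jn|_]; last first.
      by rewrite (@le_trans _ _ 0)// oppr_le0.
    by rewrite (sold_rare t j jn)// Veq0 posted_ge0.
apply: le_trans (ler_sum _ (fun j _ => item j)).
rewrite !sumrB sumr_const card_ord -mulr_suml -cE -mulr_sumr -mulr_suml.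
rewrite -mulr_natl; lra.
Qed.

End simulation.

(** * Measurability of the outcome of posted prices *)

Section measurability.
Context {R : realType} {n m : nat} {d : measure_display}.
Context {Omega : measurableType d}.
Variable p : Omega -> 'I_m -> R.
Hypothesis mp : forall j, measurable_fun setT (p ^~ j).

Lemma measurable_value (v : Omega -> setfun R m) B :
  measurable_fun setT v -> measurable_fun setT (fun w => value (v w) B).
Proof. by move=> /measurable_fun_tnthP/(_ (enum_rank B)). Qed.

Lemma measurable_utility (v : Omega -> setfun R m) B :
  measurable_fun setT v -> measurable_fun setT (fun w => utility (v w) (p w) B).
Proof.
move=> mv; apply: measurable_funB; first exact: measurable_value.
rewrite (_ : (fun w => _) = fun w =>
    \sum_j if j \in B then p w j else 0); last first.
  by apply/funext => w; rewrite big_mkcond.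
by apply: measurable_sum => j; case: (j \in B).
Qed.

Lemma measurable_buy (v : Omega -> setfun R m) U :
  measurable_fun setT v -> measurable_levels (fun w => buy (v w) (p w) U).
Proof.
move=> mv.
(* The purchase depends on the utilities only through the finitely many comparisons between
   bundles. *)
pose cmp w := [ffun BC : {set 'I_m} * {set 'I_m} =>
  utility (v w) (p w) BC.2 <= utility (v w) (p w) BC.1].
have mcmp : measurable_levels cmp.
  apply: measurable_levels_ffun => BC; apply: measurable_levels_bool.
  by apply: measurable_fun_ler; exact: measurable_utility.
pose h (f : {ffun {set 'I_m} * {set 'I_m} -> bool}) : {set 'I_m} := tie_empty
  [set B : {set 'I_m} | (B \subset U) &&
    [forall C : {set 'I_m}, (C \subset U) ==> f (B, C)]]%SET.
rewrite (_ : (fun w => _) = h \o cmp); first exact: measurable_levels_comp.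
apply/funext => w; rewrite /h/= /buy; congr tie_empty; apply/finset.setP => B.
rewrite !inE; congr (_ && _); apply: eq_forallb => C.
by rewrite ffunE.
Qed.

Lemma measurable_remaining (x : Omega -> profile R n m) t :
  measurable_fun setT x -> measurable_levels (fun w => remaining (p w) (x w) t).
Proof.
move=> mx; elim: t => [|t IH] /=; first exact: measurable_levels_cst.
case: insub => [i|//].
have mS (U : {set 'I_m}) : measurable_levels
    (fun w => (U :\: buy (tnth (x w) i) (p w) U)%SET).
  apply: (measurable_levels_comp (fun B : {set 'I_m} => (U :\: B)%SET)).
  by apply: measurable_buy; by move/measurable_fun_tnthP/(_ i): mx.
exact: (measurable_levels_dep IH mS).
Qed.

Lemma measurable_max_utility (v : Omega -> setfun R m) (U : Omega -> {set 'I_m}) :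
  measurable_fun setT v -> measurable_levels U ->
  measurable_fun setT (fun w => max_utility (v w) (p w) (U w)).
Proof.
move=> mv mU.
apply: (measurable_levels_fun (G := fun U w => max_utility (v w) (p w) U)) => // B.
rewrite /max_utility; elim: (index_enum _) => [|C s IH].
  by under eq_fun do rewrite big_nil; exact: measurable_cst.
under eq_fun do rewrite big_cons; case: (C \subset B) => //.
by apply: measurable_maxr => //; exact: measurable_utility.
Qed.

Lemma measurable_revenue (U : Omega -> {set 'I_m}) : measurable_levels U ->
  measurable_fun setT (fun w => \sum_(j in U w) p w j).
Proof.
move=> mU; apply: (measurable_levels_fun
  (G := fun (U : {set 'I_m}) w => \sum_(j in U) p w j)) => // B.
rewrite (_ : (fun w => _) = fun w =>
    \sum_j if j \in B then p w j else 0); last first.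
  by apply/funext => w; rewrite big_mkcond.
by apply: measurable_sum => j; case: (j \in B).
Qed.

Lemma measurable_ghost_welfare (x y : Omega -> profile R n m) :
  measurable_fun setT x -> measurable_fun setT y ->
  measurable_fun setT (fun w => ghost_welfare (p w) (x w) (y w)).
Proof.
move=> mx my; apply: measurable_funD.
  apply: measurable_revenue.
  apply: (measurable_levels_comp (fun B : {set 'I_m} => (~: B)%SET)).
  exact: measurable_remaining.
apply: measurable_sum => i; apply: measurable_max_utility.
  by move/measurable_fun_tnthP/(_ i): mx.
exact: measurable_remaining.
Qed.

End measurability.

Section measurability_profile.
Context {R : realType} {n m : nat} {d : measure_display}.
Context {Omega : measurableType d}.

Lemma measurable_total_value (x : Omega -> profile R n m) :
  measurable_fun setT x -> measurable_fun setT (fun w => total_value (x w)).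
Proof.
move=> mx; apply: measurable_sum => i; apply: measurableT_comp => //.
by apply: measurable_value; by move/measurable_fun_tnthP/(_ i): mx.
Qed.

Lemma measurable_welfare (x : Omega -> profile R n m)
    (A : 'I_n -> Omega -> {set 'I_m}) :
  measurable_fun setT x -> (forall i, measurable_levels (A i)) ->
  measurable_fun setT (fun w => welfare (x w) (A ^~ w)).
Proof.
move=> mx mA; apply: measurable_sum => i.
apply: (measurable_levels_fun (G := fun B w => value (tnth (x w) i) B)) => // B.
by apply: measurable_value; by move/measurable_fun_tnthP/(_ i): mx.
Qed.

Lemma measurable_sold_sets K (delta : Omega -> R)
    (xs : Omega -> nat -> profile R n m) t :
  measurable_fun setT delta -> (forall t, measurable_fun setT (xs ^~ t)) ->
  measurable_levels (fun w => sold_sets K (delta w) (xs w) t).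
Proof.
move=> mdelta mxs; elim: t => [|t IH] /=; first exact: measurable_levels_cst.
pose G (h : seq {set 'I_m}) w :=
  (~: remaining (posted K (delta w) h) (xs w t) n)%SET :: h.
have mG h : measurable_levels (G h).
  apply: (measurable_levels_comp (fun B : {set 'I_m} => (~: B)%SET :: h)).
  apply: measurable_remaining => // j.
  by apply: measurable_funM => //; exact: measurable_cst.
exact: (measurable_levels_dep IH mG).
Qed.

Lemma measurable_posted K (delta : Omega -> R)
    (xs : Omega -> nat -> profile R n m) t j :
  measurable_fun setT delta -> (forall t, measurable_fun setT (xs ^~ t)) ->
  measurable_fun setT
    (fun w => posted K (delta w) (sold_sets K (delta w) (xs w) t) j).
Proof.
move=> mdelta mxs.
apply: (measurable_levels_fun (G := fun h w => posted K (delta w) h j)) => [|h].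
  exact: measurable_sold_sets.
by apply: measurable_funM => //; exact: measurable_cst.
Qed.

End measurability_profile.

Lemma measurable_opt {R : realType} {n m : nat} :
  measurable_fun setT (@opt R n m).
Proof.
rewrite /opt; elim: (index_enum _) => [|A s IH].
  by under eq_fun do rewrite big_nil; exact: measurable_cst.
under eq_fun do rewrite big_cons; case: (allocation A) => //.
apply: measurable_maxr => //.
apply: (measurable_welfare (x := id) (A := fun i _ => A i)) => // i.
exact: measurable_levels_cst.
Qed.

(** * The random round and the mechanism *)

Section uniform_seed.
Context {R : realType} (T : nat).

Let invT_ge0 : 0 <= T.+1%:R^-1 :> R. Proof. by rewrite invr_ge0. Qed.

Definition uniform_seed : set nat -> \bar R :=
  mscale (NngNum invT_ge0) (msum (fun t : nat => \d_t) T.+1).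

HB.instance Definition _ := Measure.on uniform_seed.

Lemma ge0_integral_uniform_seed (f : nat -> \bar R) : (forall t, 0 <= f t)%E ->
  (\int[uniform_seed]_t f t = T.+1%:R^-1%:E * \sum_(t < T.+1) f t)%E.
Proof.
move=> f0; rewrite ge0_integral_mscale//= ge0_integral_measure_sum//.
congr (_ * _)%E; apply: eq_bigr => t _.
by rewrite integral_dirac//= diracT mul1e.
Qed.

Let uniform_seed_setT : uniform_seed setT = 1%:E.
Proof.
rewrite /uniform_seed /mscale/=.
have -> : msum (fun t : nat => \d_t) T.+1 [set: nat] =
    (\sum_(t < T.+1) (1%:E : \bar R))%E.
  by apply: eq_bigr => t _; rewrite /= diracT.
by rewrite sumEFin sumr_const card_ord -EFinM mulVf.
Qed.

HB.instance Definition _ :=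
  Measure_isProbability.Build _ _ _ uniform_seed uniform_seed_setT.

End uniform_seed.

Section mechanism.
Context {R : realType} {n m : nat} (N T K L : nat).
Implicit Types (s : (N + T.+1).-tuple (profile R n m)).

(** The first [N] samples set the scale; the last [T.+1] feed the simulated rounds. *)
Definition price_scale s : R :=
  \sum_(r < N) total_value (tnth s (lshift T.+1 r)).

Definition grid_step s : R := L%:R * price_scale s / K%:R.

(** The zero profile is a default beyond the last round, which the seed exceeds with probability
    0. *)
Definition round_profile s (t : nat) : profile R n m :=
  if insub t is Some i then tnth s (rshift N (i : 'I_T.+1))
  else [tuple of nseq n [tuple of nseq #|{set 'I_m}| (0 : R)]].

Definition round_price (t : nat) s (j : 'I_m) : R :=
  posted K (grid_step s) (sold_sets K (grid_step s) (round_profile s) t) j.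

Lemma price_scale_ge0 s : 0 <= price_scale s.
Proof. by apply: sumr_ge0 => r _; exact: sumr_ge0. Qed.

Lemma grid_step_ge0 s : 0 <= grid_step s.
Proof. by rewrite divr_ge0// mulr_ge0// price_scale_ge0. Qed.

Lemma round_profile_ord s (t : 'I_T.+1) : round_profile s t = tnth s (rshift N t).
Proof. by rewrite /round_profile valK. Qed.

Lemma price_scale_replace s (t : 'I_T.+1) y :
  price_scale (replace (rshift N t) s y) = price_scale s.
Proof.
by apply: eq_bigr => r _; rewrite tnth_replace eq_lrshift.
Qed.

(** The prices of round [t] use only the scale and the rounds before [t]; this is what makes the
    sample of round [t] independent of them. *)
Lemma round_price_replace s (t : 'I_T.+1) y :
  round_price t (replace (rshift N t) s y) = round_price t s.
Proof.
apply/funext => j; rewrite /round_price /grid_step price_scale_replace.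
congr posted; apply: eq_sold_sets => u ut; rewrite /round_profile.
case: insubP => // i _ iu; rewrite tnth_replace eq_rshift -val_eqE/= iu.
by rewrite ltn_eqF.
Qed.

Section measurability.
Context {d : measure_display} {Omega : measurableType d}.
Variable s : Omega -> (N + T.+1).-tuple (profile R n m).
Hypothesis ms : measurable_fun setT s.

Lemma measurable_price_scale : measurable_fun setT (fun w => price_scale (s w)).
Proof.
apply: measurable_sum => r; apply: measurable_total_value.
by move/measurable_fun_tnthP/(_ (lshift T.+1 r)): ms.
Qed.

Lemma measurable_grid_step : measurable_fun setT (fun w => grid_step (s w)).
Proof.
apply: measurable_funM => //; apply: measurable_funM => //.
exact: measurable_price_scale.
Qed.

Lemma measurable_round_profile t :
  measurable_fun setT (fun w => round_profile (s w) t).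
Proof.
rewrite /round_profile; case: insub => [i|//].
by move/measurable_fun_tnthP/(_ (rshift N i)): ms.
Qed.

Lemma measurable_round_price t j :
  measurable_fun setT (fun w => round_price t (s w) j).
Proof.
apply: measurable_posted; first exact: measurable_grid_step.
exact: measurable_round_profile.
Qed.

End measurability.

Lemma measurable_seed_price (d : measure_display) (Omega : measurableType d)
    (t : Omega -> nat) (s : Omega -> (N + T.+1).-tuple (profile R n m)) j :
  measurable_fun setT t -> measurable_fun setT s ->
  measurable_fun setT (fun w => round_price (t w) (s w) j).
Proof.
move=> mt ms.
apply: (measurable_levels_fun (G := fun u w => round_price u (s w) j)) => u.
  by rewrite -[X in measurable X]setTI; exact: (mt measurableT [set u]).
exact: measurable_round_price.
Qed.

Lemma measurable_mechanism_price (i : 'I_n) (j : 'I_m) : measurable_fun setT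
  (fun x : nat * (N + T.+1).-tuple (profile R n m) * i.-tuple (setfun R m) =>
     round_price x.1.1 x.1.2 j).
Proof.
apply: measurable_seed_price.
  exact: (measurableT_comp measurable_fst measurable_fst).
exact: (measurableT_comp measurable_snd measurable_fst).
Qed.

Lemma measurable_mechanism_tie (i : 'I_n) (F : {set {set 'I_m}})
    (B : {set 'I_m}) : measurable
  [set x : nat * (N + T.+1).-tuple (profile R n m) * i.-tuple (setfun R m) |
     tie_empty F = B].
Proof.
exact: (@measurable_levels_cst _ (nat * (N + T.+1).-tuple (profile R n m) *
  i.-tuple (setfun R m))%type _ (tie_empty F) B).
Qed.

(** The seed is the round number. Given seed and samples, all buyers face one static price
    vector. *)
Definition learned_prices : mechanism R n m (N + T.+1) :=
  @Mechanism R n m (N + T.+1) _ nat (uniform_seed T)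
    (fun _ t s _ j => round_price t s j) (fun _ _ _ _ F => tie_empty F)
    (fun _ _ s _ _ => posted_ge0 _ _ _ (grid_step_ge0 s))
    (fun _ _ _ _ F F0 => tie_empty_in F0)
    measurable_mechanism_price measurable_mechanism_tie.

Lemma unsold_learned_prices (t : nat) s v u :
  unsold (learned_prices) t s v u = remaining (round_price t s) v u.
Proof. by elim: u => [//|u /= ->]. Qed.

Lemma bundle_learned_prices (t : nat) s v i :
  bundle (learned_prices) t s v i =
  buy (tnth v i) (round_price t s) (remaining (round_price t s) v i).
Proof. by rewrite /bundle unsold_learned_prices. Qed.

End mechanism.

(** * Expectations *)

Lemma measurable_EFin_fun {R : realType} d (T : measurableType d) (f : T -> R) :
  measurable_fun setT f -> measurable_fun setT (fun x => (f x)%:E).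
Proof. by move/measurable_EFinP. Qed.

Section real_integrals.
Context {R : realType} {d : measure_display} {T : measurableType d}.
Variable P : probability T R.
Implicit Types f g : T -> R.

Lemma ge0_integral_EFinD f g : measurable_fun setT f -> measurable_fun setT g ->
  (forall x, 0 <= f x) -> (forall x, 0 <= g x) ->
  (\int[P]_x (f x + g x)%:E = \int[P]_x (f x)%:E + \int[P]_x (g x)%:E)%E.
Proof.
move=> mf mg f0 g0; under eq_integral do rewrite EFinD.
by rewrite ge0_integralD//; try (exact: measurable_EFin_fun);
  move=> x _; rewrite lee_fin.
Qed.

Lemma ge0_integral_EFin_sum (I : finType) (F : I -> T -> R) :
  (forall i, measurable_fun setT (F i)) -> (forall i x, 0 <= F i x) ->
  (\int[P]_x (\sum_i F i x)%:E = \sum_i \int[P]_x (F i x)%:E)%E.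
Proof.
move=> mF F0; under eq_integral do rewrite -sumEFin.
rewrite ge0_integral_sum// => [i|i x _]; last by rewrite lee_fin.
exact: measurable_EFin_fun.
Qed.

Lemma ge0_integral_EFinZ k f : 0 <= k -> measurable_fun setT f ->
  (forall x, 0 <= f x) ->
  (\int[P]_x (k * f x)%:E = k%:E * \int[P]_x (f x)%:E)%E.
Proof.
move=> k0 mf f0; under eq_integral do rewrite EFinM.
rewrite ge0_integralZl_EFin//; last exact: measurable_EFin_fun.
by move=> x _; rewrite lee_fin.
Qed.

Lemma le_integral_EFin f g : measurable_fun setT f -> measurable_fun setT g ->
  (forall x, 0 <= f x) -> (forall x, f x <= g x) ->
  (\int[P]_x (f x)%:E <= \int[P]_x (g x)%:E)%E.
Proof.
move=> mf mg f0 fg; apply: ge0_le_integral => //; try (exact: measurable_EFin_fun);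
  by move=> x _; rewrite lee_fin.
Qed.

Lemma ae_le_integral_EFin f g : measurable_fun setT f -> measurable_fun setT g ->
  (forall x, 0 <= f x) -> (forall x, 0 <= g x) ->
  {ae P, forall x, f x <= g x} ->
  (\int[P]_x (f x)%:E <= \int[P]_x (g x)%:E)%E.
Proof.
move=> mf mg f0 g0 fg; apply: ae_ge0_le_integral => //;
  try (exact: measurable_EFin_fun); try (by move=> x _; rewrite lee_fin).
by apply: filterS fg => x; rewrite lee_fin.
Qed.

Lemma measurable_integral_EFin d' (U : measurableType d') (Q : probability U R)
    (h : T -> U -> R) :
  measurable_fun setT (fun z : T * U => h z.1 z.2) ->
  (forall x y, 0 <= h x y) ->
  measurable_fun setT (fun x => \int[Q]_y (h x y)%:E)%E.
Proof.
move=> mh h0; apply: measurable_integral => [|x y]; last by rewrite lee_fin.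
exact: measurable_EFin_fun.
Qed.

Lemma tonelli_EFin d' (U : measurableType d') (Q : probability U R)
    (h : T -> U -> R) :
  measurable_fun setT (fun z : T * U => h z.1 z.2) ->
  (forall x y, 0 <= h x y) ->
  (\int[P]_x \int[Q]_y (h x y)%:E = \int[Q]_y \int[P]_x (h x y)%:E)%E.
Proof.
move=> mh h0.
rewrite (fubini_tonelli (fun z : T * U => (h z.1 z.2)%:E))//.
  exact: measurable_EFin_fun.
by move=> z; rewrite lee_fin.
Qed.

Lemma ae_snd d' (U : measurableType d') (Q : probability U R) (A : U -> Prop) :
  {ae Q, forall y, A y} -> {ae (P \x Q)%E, forall z, A z.2}.
Proof.
move=> [N [mN N0 AN]]; exists (setT `*` N); split.
- exact: measurableX.
- transitivity (P setT * Q N)%E; first exact: product_measure1E.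
  by rewrite N0 mule0.
- by move=> z /= nA; split => //; exact: AN.
Qed.

End real_integrals.

(** * Comparison of ghost welfare with posted-price welfare *)

Section posted_welfare.
Context {R : realType} {n m : nat}.
Variable D : 'I_n -> probability (setfun R m) R.
Let mu := prod_prob D.

(** By [welfare_posted] this is the welfare whenever empty sets have value 0. Unlike [welfare], it
    is nonnegative on all profiles when prices are, so Tonelli's theorem applies. *)
Definition posted_welfare (p : 'I_m -> R) (v : profile R n m) : R :=
  \sum_(j in ~: remaining p v n) p j +
  \sum_i max_utility (tnth v i) p (remaining p v i).

Lemma posted_welfare_ge0 p v : (forall j, 0 <= p j) -> 0 <= posted_welfare p v.
Proof.
by move=> p0; rewrite addr_ge0// sumr_ge0// => i _; exact: max_utility_ge0.
Qed.

Lemma ghost_welfare_ge0 p (v y : profile R n m) :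
  (forall j, 0 <= p j) -> 0 <= ghost_welfare p v y.
Proof.
by move=> p0; rewrite addr_ge0// sumr_ge0// => i _; exact: max_utility_ge0.
Qed.

Lemma measurable_posted_welfare d (Omega : measurableType d)
    (p : Omega -> 'I_m -> R) (x : Omega -> profile R n m) :
  (forall j, measurable_fun setT (p ^~ j)) -> measurable_fun setT x ->
  measurable_fun setT (fun w => posted_welfare (p w) (x w)).
Proof.
move=> mp mx; apply: measurable_funD.
  apply: measurable_revenue => //.
  apply: (measurable_levels_comp (fun B : {set 'I_m} => (~: B)%SET)).
  exact: measurable_remaining.
apply: measurable_sum => i; apply: measurable_max_utility => //.
  by move/measurable_fun_tnthP/(_ i): mx.
exact: measurable_remaining.
Qed.

(* The set of items left to buyer i depends on the earlier buyers only, so it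
   can be computed from an independent copy of the profile. *)
Lemma integral_max_utility p i :
  (\int[mu]_v (max_utility (tnth v i) p (remaining p v i))%:E =
   \int[mu]_v \int[mu]_y (max_utility (tnth v i) p (remaining p y i))%:E)%E.
Proof.
have mcst d (Omega : measurableType d) j :
    measurable_fun setT (fun _ : Omega => p j) by exact: measurable_cst.
have mg : measurable_fun setT (fun z : setfun R m * profile R n m =>
    max_utility z.1 p (remaining p z.2 i)).
  apply: (measurable_max_utility (p := fun=> p) (@mcst _ _)
    (v := fst)
    (U := fun z => remaining p z.2 i)) => //.
  exact: (measurable_remaining (p := fun=> p) (@mcst _ _) (x := snd)).
have mf : measurable_fun setT (fun v : profile R n m =>
    (max_utility (tnth v i) p (remaining p v i))%:E).
  apply: measurable_EFin_fun.
  apply: (measurable_max_utility (p := fun=> p) (@mcst _ _)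
    (v := fun v => tnth v i)
    (U := fun v => remaining p v i)) => //; first exact: measurable_tnth.
  exact: (measurable_remaining (p := fun=> p) (@mcst _ _) (x := id)).
rewrite (ge0_integral_replace D i)//; last first.
  by move=> v; rewrite lee_fin max_utility_ge0.
under eq_integral => v _.
  under eq_integral => z _.
    rewrite tnth_replace eqxx (_ : remaining p _ i = remaining p v i); last first.
      apply: eq_remaining => j ji; rewrite tnth_replace ifN//.
      by apply: contraTneq ji => ->; rewrite ltnn.
    over.
  over.
rewrite -(tonelli_EFin (D i) mu
  (h := fun z v => max_utility z p (remaining p v i)))//; last first.
  by move=> *; exact: max_utility_ge0.
rewrite -(ge0_integral_tnth D i)//; first last.
- by move=> x; apply: integral_ge0 => y _; rewrite lee_fin max_utility_ge0.
- by apply: measurable_integral_EFin => // x y; exact: max_utility_ge0.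
Qed.

(** Buyer [i] still finds all the items that remain at the end, and by [integral_max_utility] the
    set found on arrival may be computed from the copy [y]. *)
Lemma ghost_le_posted p : (forall j, 0 <= p j) ->
  (\int[mu]_v \int[mu]_y (ghost_welfare p v y)%:E <=
   \int[mu]_v (posted_welfare p v)%:E)%E.
Proof.
move=> p0.
have mcst d (Omega : measurableType d) j :
    measurable_fun setT (fun _ : Omega => p j) by exact: measurable_cst.
have mrem t : measurable_levels (fun v : profile R n m => remaining p v t).
  exact: (measurable_remaining (p := fun=> p) (@mcst _ _) (x := id)).
have mrev : measurable_fun setT (fun v : profile R n m =>
    \sum_(j in ~: remaining p v n) p j).
  apply: (measurable_revenue (p := fun=> p) (@mcst _ _)
    (U := fun v => (~: remaining p v n)%SET)) => //.
  exact: (measurable_levels_comp (fun B : {set 'I_m} => (~: B)%SET) (mrem n)).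
have rev0 (v : profile R n m) : 0 <= \sum_(j in ~: remaining p v n) p j.
  exact: sumr_ge0.
have mu0 (v : setfun R m) U : 0 <= max_utility v p U := max_utility_ge0 v p U.
have mmu i : measurable_fun setT (fun v : profile R n m =>
    max_utility (tnth v i) p (remaining p v i)).
  apply: (measurable_max_utility (p := fun=> p) (@mcst _ _)
    (v := fun v => tnth v i)
    (U := fun v => remaining p v i)) => //; exact: measurable_tnth.
have mmu2 t i : measurable_fun setT (fun z : profile R n m * profile R n m =>
    max_utility (tnth z.1 i) p (remaining p z.2 t)).
  apply: (measurable_max_utility (p := fun=> p) (@mcst _ _)
    (v := fun z => tnth z.1 i)
    (U := fun z => remaining p z.2 t)) => //.
    exact: (measurableT_comp (measurable_tnth i) measurable_fst).
  exact: (measurable_remaining (p := fun=> p) (@mcst _ _) (x := snd)).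
have mmu1 t i v : measurable_fun setT (fun y : profile R n m =>
    max_utility (tnth v i) p (remaining p y t)).
  exact: (measurable_max_utility (p := fun=> p) (@mcst _ _)
    (v := fun=> tnth v i)
    (U := fun y => remaining p y t)).
rewrite /posted_welfare ge0_integral_EFinD//; first last.
- by move=> v; exact: sumr_ge0.
- exact: measurable_sum.
rewrite (ge0_integral_EFin_sum mu mmu)//.
have E v : (\int[mu]_y (ghost_welfare p v y)%:E =
    \int[mu]_y (\sum_(j in ~: remaining p y n) p j)%:E +
    \sum_i \int[mu]_y (max_utility (tnth v i) p (remaining p y n))%:E)%E.
  rewrite ge0_integral_EFinD//.
  - by rewrite ge0_integral_EFin_sum// => i; exact: mmu1.
  - by apply: measurable_sum => i; exact: mmu1.
  - by move=> y; exact: sumr_ge0.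
under eq_integral do rewrite E.
have mI i : measurable_fun setT (fun v : profile R n m =>
    \int[mu]_y (max_utility (tnth v i) p (remaining p y n))%:E)%E.
  by apply: measurable_integral_EFin => //; exact: mmu2.
have I0 i v : (0 <= \int[mu]_y (max_utility (tnth v i) p (remaining p y n))%:E)%E.
  by apply: integral_ge0 => y _; rewrite lee_fin.
rewrite ge0_integralD//; first last.
- by apply: emeasurable_sum.
- by move=> v _; apply: sume_ge0 => i _; exact: I0.
- by move=> v _; apply: integral_ge0 => y _; rewrite lee_fin.
rewrite integral_probability_cst leeD2l// ge0_integral_sum//.
apply: lee_sum => i _; rewrite integral_max_utility.
apply: ge0_le_integral => //.
- by apply: measurable_integral_EFin => //; exact: mmu2.
- by apply: measurable_integral_EFin => //; exact: mmu2.
move=> v _; apply: le_integral_EFin => //; [exact: mmu1|exact: mmu1|move=> y].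
by rewrite max_utility_mono// remaining_mono// ltnW.
Qed.

End posted_welfare.

Lemma ge0_integral_prod3 {R : realType} d1 d2 d3 (T1 : measurableType d1)
    (T2 : measurableType d2) (T3 : measurableType d3) (P1 : probability T1 R)
    (P2 : probability T2 R) (P3 : probability T3 R) (f : T1 -> T2 -> T3 -> R) :
  measurable_fun setT (fun z : T1 * T2 * T3 => f z.1.1 z.1.2 z.2) ->
  (forall x y z, 0 <= f x y z) ->
  (\int[(P1 \x P2) \x P3]_z (f z.1.1 z.1.2 z.2)%:E =
   \int[P1]_x \int[P2]_y \int[P3]_z (f x y z)%:E)%E.
Proof.
move=> mf f0.
pose P12 : probability (T1 * T2)%type R := (P1 \x P2)%E.
transitivity (\int[P12]_w \int[P3]_z (f w.1 w.2 z)%:E)%E.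
  apply: (fubini_tonelli1 (m1 := P12) (m2 := P3)
    (fun z => (f z.1.1 z.1.2 z.2)%:E)); first exact: measurable_EFin_fun.
  by move=> z; rewrite lee_fin.
apply: (fubini_tonelli1 (m1 := P1) (m2 := P2)
  (fun w => \int[P3]_z (f w.1 w.2 z)%:E)%E).
- exact: (measurable_integral_EFin P3 (h := fun w z => f w.1 w.2 z)).
- by move=> z; apply: integral_ge0 => y _; rewrite lee_fin.
Qed.

Section expectations.
Context {R : realType} {n m : nat} (N T K L : nat).
Variable D : 'I_n -> probability (setfun R m) R.
Hypothesis D_xos : forall i, {ae D i, forall v, xos v}.

Local Notation mu := (prod_prob D).
Local Notation nu := (prod_prob (fun _ : 'I_(N + T.+1) => mu)).
Local Notation samples := ((N + T.+1).-tuple (profile R n m)).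
Local Notation price t s := (@round_price R n m N T K L t s).

Lemma ae_xos_profile : {ae mu, forall v, forall i, xos (tnth v i)}.
Proof. exact: (ae_prod_prob (P := fun _ v => xos v)). Qed.

Lemma ae_xos_samples : {ae nu, forall s, forall r i, xos (tnth (tnth s r) i)}.
Proof.
apply: (ae_prod_prob (P := fun _ x => forall i, xos (tnth x i))) => _.
exact: ae_xos_profile.
Qed.

Lemma price_ge0 t s j : 0 <= price t s j.
Proof. exact: posted_ge0 (grid_step_ge0 _ _ _). Qed.

Lemma expected_welfare_learned_prices :
  (expected_welfare (learned_prices N T K L) D =
   T.+1%:R^-1%:E * \sum_(t < T.+1)
     \int[nu]_s \int[mu]_v (posted_welfare (price t s) v)%:E)%E.
Proof.
pose Om := (nat * samples * profile R n m)%type.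
have m11 : measurable_fun setT (fun z : Om => z.1.1).
  exact: (measurableT_comp measurable_fst measurable_fst).
have m12 : measurable_fun setT (fun z : Om => z.1.2).
  exact: (measurableT_comp measurable_snd measurable_fst).
have mp j : measurable_fun setT (fun z : Om => price z.1.1 z.1.2 j).
  exact: measurable_seed_price.
have mv i : measurable_fun setT (fun z : Om => tnth z.2 i).
  exact: (measurableT_comp (measurable_tnth i) measurable_snd).
have mpw : measurable_fun setT (fun z : Om =>
    posted_welfare (price z.1.1 z.1.2) z.2).
  by apply: measurable_posted_welfare => //; exact: measurable_snd.
have mw : measurable_fun setT (fun z : Om => welfare z.2 (fun i =>
    buy (tnth z.2 i) (price z.1.1 z.1.2) (remaining (price z.1.1 z.1.2) z.2 i))).
  apply: (measurable_welfare (x := snd) (A := fun i (z : Om) =>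
    buy (tnth z.2 i) (price z.1.1 z.1.2) (remaining (price z.1.1 z.1.2) z.2 i))).
    exact: measurable_snd.
  move=> i; apply: (measurable_levels_dep (G := fun U (z : Om) =>
    buy (tnth z.2 i) (price z.1.1 z.1.2) U)) => [|U].
    by apply: measurable_remaining => //; exact: measurable_snd.
  exact: measurable_buy.
have pw0 (z : Om) : (0 <= (posted_welfare (price z.1.1 z.1.2) z.2)%:E)%E.
  by rewrite lee_fin posted_welfare_ge0// => j; exact: price_ge0.
have -> : expected_welfare (learned_prices N T K L) D =
    (\int[(uniform_seed T \x nu) \x mu]_z
       (posted_welfare (price z.1.1 z.1.2) z.2)%:E)%E.
  rewrite /expected_welfare.
  under eq_integral => z _.
    rewrite (_ : bundle _ _ _ _ = (fun i => buy (tnth z.2 i)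
      (price z.1.1 z.1.2) (remaining (price z.1.1 z.1.2) z.2 i))); last first.
      by apply/funext => i; rewrite bundle_learned_prices.
    over.
  (* The integrands are compared only where all coordinates are XOS, which gives empty sets value
     0. *)
  apply: ae_eq_integral; [exact: measurableT|exact: measurable_EFin_fun|
    exact: measurable_EFin_fun|].
  have := ae_snd (uniform_seed T \x nu)%E ae_xos_profile.
  apply: filterS => z zx _; congr EFin.
  by rewrite welfare_posted// => i; have [[]] := zx i.
rewrite (ge0_integral_prod3 (uniform_seed T) nu mu
  (f := fun t s v => posted_welfare (price t s) v) mpw); last first.
  by move=> t s v; apply: posted_welfare_ge0 => j; exact: price_ge0.
rewrite ge0_integral_uniform_seed//.
move=> t; apply: integral_ge0 => s _; apply: integral_ge0 => v _.
by rewrite lee_fin; apply: posted_welfare_ge0 => j; exact: price_ge0.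
Qed.

End expectations.

(** * The simulated rounds in expectation *)

Section simulated_welfare.
Context {R : realType} {n m : nat} (N T K L : nat).
Variable D : 'I_n -> probability (setfun R m) R.
Hypothesis D_xos : forall i, {ae D i, forall v, xos v}.

Local Notation mu := (prod_prob D).
Local Notation nu := (prod_prob (fun _ : 'I_(N + T.+1) => mu)).
Local Notation samples := ((N + T.+1).-tuple (profile R n m)).
Local Notation price t s := (@round_price R n m N T K L t s).

Definition simulated_welfare (v : profile R n m) (s : samples) : R :=
  \sum_(t < T.+1) ghost_welfare (price t s) v (round_profile s t).

Lemma simulated_welfare_ge0 v s : 0 <= simulated_welfare v s.
Proof.
apply: sumr_ge0 => t _; apply: ghost_welfare_ge0 => j; exact: price_ge0.
Qed.

Lemma measurable_simulated_welfare d (Omega : measurableType d)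
    (v : Omega -> profile R n m) (s : Omega -> samples) :
  measurable_fun setT v -> measurable_fun setT s ->
  measurable_fun setT (fun w => simulated_welfare (v w) (s w)).
Proof.
move=> mv ms; apply: measurable_sum => t; apply: measurable_ghost_welfare => //.
  by move=> j; exact: measurable_round_price.
exact: measurable_round_profile.
Qed.

(* The prices of round [t] are computed before the sample of round [t] is
   read, so this sample can play the role of the independent copy. *)
Lemma integral_ghost_welfare (t : 'I_T.+1) v :
  (\int[nu]_s \int[mu]_y (ghost_welfare (price t s) v y)%:E =
   \int[nu]_s (ghost_welfare (price t s) v (round_profile s t))%:E)%E.
Proof.
rewrite [RHS](ge0_integral_replace _ (rshift N t)).
- apply: eq_integral => s _; apply: eq_integral => y _.
  by rewrite round_price_replace round_profile_ord tnth_replace eqxx.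
- apply: measurable_EFin_fun; apply: measurable_ghost_welfare => //.
    by move=> j; exact: (measurable_round_price K L (s := id)).
  exact: (measurable_round_profile (s := id)).
- by move=> s; rewrite lee_fin ghost_welfare_ge0// => j; exact: price_ge0.
Qed.

(** The seed averages over the rounds. In each round the sample is traded for an independent copy,
    and [ghost_le_posted] is applied with the prices frozen. *)
Lemma simulated_le_expected_welfare :
  (T.+1%:R^-1%:E * \int[mu]_v \int[nu]_s (simulated_welfare v s)%:E <=
   expected_welfare (learned_prices N T K L) D)%E.
Proof.
rewrite expected_welfare_learned_prices//.
apply: lee_wpmul2l; first by rewrite lee_fin invr_ge0.
have gw0 t s (v y : profile R n m) : 0 <= ghost_welfare (price t s) v y.
  by apply: ghost_welfare_ge0 => j; exact: price_ge0.
have mg t : measurable_fun setT (fun z : samples * profile R n m =>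
    ghost_welfare (price t z.1) z.2 (round_profile z.1 t)).
  apply: measurable_ghost_welfare; last 2 first.
  - exact: measurable_snd.
  - by apply: measurable_round_profile; exact: measurable_fst.
  by move=> j; apply: measurable_round_price; exact: measurable_fst.
have mg2 t (v : profile R n m) : measurable_fun setT
    (fun z : samples * profile R n m => ghost_welfare (price t z.1) v z.2).
  apply: measurable_ghost_welfare; [|exact: measurable_cst|exact: measurable_snd].
  by move=> j; apply: measurable_round_price; exact: measurable_fst.
have mg3 t (s : samples) : measurable_fun setT
    (fun z : profile R n m * profile R n m => ghost_welfare (price t s) z.1 z.2).
  apply: measurable_ghost_welfare; [|exact: measurable_fst|exact: measurable_snd].
  by move=> j; exact: measurable_cst.
have mg4 t : measurable_fun setT
    (fun z : (samples * profile R n m) * profile R n m =>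
       ghost_welfare (price t z.1.1) z.1.2 z.2).
  apply: measurable_ghost_welfare; [| |exact: measurable_snd]; last first.
    exact: (measurableT_comp measurable_snd measurable_fst).
  move=> j; apply: measurable_round_price.
  exact: (measurableT_comp measurable_fst measurable_fst).
rewrite [X in (X <= _)%E](_ : _ = \sum_(t < T.+1)
    \int[nu]_s \int[mu]_v \int[mu]_y (ghost_welfare (price t s) v y)%:E)%E.
  apply: lee_sum => t _; apply: ge0_le_integral => //.
  - move=> s _; apply: integral_ge0 => v _; apply: integral_ge0 => y _.
    by rewrite lee_fin.
  - apply: measurable_integral => [|s v]; last first.
      by apply: integral_ge0 => y _; rewrite lee_fin.
    by apply: (measurable_integral_EFin mu
      (h := fun w y => ghost_welfare (price t w.1) w.2 y)) => [|? ?];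
      [exact: mg4|exact: gw0].
  - apply: measurable_integral_EFin => [|s v]; last first.
      by apply: posted_welfare_ge0 => j; exact: price_ge0.
    apply: measurable_posted_welfare; last exact: measurable_snd.
    by move=> j; apply: measurable_round_price; exact: measurable_fst.
  - by move=> s _; apply: ghost_le_posted => j; exact: price_ge0.
transitivity (\int[mu]_v \sum_(t < T.+1)
    \int[nu]_s (ghost_welfare (price t s) v (round_profile s t))%:E)%E.
  apply: eq_integral => v _; rewrite ge0_integral_EFin_sum// => t.
  apply: measurable_ghost_welfare => //.
    by move=> j; exact: (measurable_round_price K L (s := id)).
  exact: (measurable_round_profile (s := id)).
rewrite ge0_integral_sum//; first last.
- by move=> t v _; apply: integral_ge0 => s _; rewrite lee_fin.
- move=> t; apply: measurable_integral_EFin => [|v s]; last exact: gw0.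
  apply: measurable_ghost_welfare; [|exact: measurable_fst|].
    by move=> j; apply: measurable_round_price; exact: measurable_snd.
  by apply: measurable_round_profile; exact: measurable_snd.
apply: eq_bigr => t _.
under eq_integral do rewrite -integral_ghost_welfare.
rewrite -(fubini_tonelli (m1 := nu) (m2 := mu)
  (fun z => \int[mu]_y (ghost_welfare (price t z.1) z.2 y)%:E)%E)//.
- by apply: (measurable_integral_EFin mu
      (h := fun w y => ghost_welfare (price t w.1) w.2 y)) => [|? ?];
      [exact: mg4|exact: gw0].
- by move=> z; apply: integral_ge0 => y _; rewrite lee_fin.
Qed.

Lemma measurable_ltr_indic d (Omega : measurableType d) (f g : Omega -> R) :
  measurable_fun setT f -> measurable_fun setT g ->
  measurable_fun setT (fun w => (f w < g w)%R%:R : R).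
Proof.
move=> mf mg.
apply: (measurable_levels_fun (F := fun w => f w < g w) 
  (G := fun (b : bool) (_ : Omega) => b%:R : R)) => //.
by apply: measurable_levels_bool; exact: measurable_fun_ltr.
Qed.

(* A fresh total value exceeds the sum of N independent copies of it with
   probability at most 1/N: after exchanging it with any of the copies, at most
   one of these N events occurs. *)
Lemma rare_sale (t : 'I_T.+1) : (0 < N)%N ->
  (\int[nu]_s ((price_scale s < total_value (round_profile s t))%R%:R)%:E <=
   (N%:R^-1)%:E)%E.
Proof.
move=> N0.
pose f (z : samples * profile R n m) : R :=
  (price_scale z.1 < total_value z.2)%R%:R.
have f0 z : 0 <= f z by exact: ler0n.
have mf : measurable_fun setT f.
  apply: measurable_ltr_indic.
    by apply: measurable_price_scale; exact: measurable_fst.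
  by apply: measurable_total_value; exact: measurable_snd.
have fE0 z : (0 <= (f z)%:E)%E by rewrite lee_fin.
have mfE := measurable_EFin_fun mf.
have mr r : measurable_fun setT (fun z : samples * profile R n m =>
    f (replace r z.1 z.2, tnth z.1 r)).
  apply: measurableT_comp => //; apply: measurable_fun_pair.
    exact: measurable_replace.
  exact: (measurableT_comp (measurable_tnth r) measurable_fst).
set q := (\int[nu]_s \int[mu]_x (f (s, x))%:E)%E.
have -> : (\int[nu]_s ((price_scale s < total_value (round_profile s t))%R%:R)%:E
    = q)%E.
  rewrite (ge0_integral_replace _ (rshift N t)).
  - apply: eq_integral => s _; apply: eq_integral => y _.
    by rewrite price_scale_replace round_profile_ord tnth_replace eqxx.
  - apply: measurable_EFin_fun; apply: measurable_ltr_indic.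
      exact: (measurable_price_scale (s := id)).
    apply: measurable_total_value; exact: (measurable_round_profile (s := id)).
  - by move=> s; rewrite lee_fin.
have qE (r : 'I_N) : q = (\int[nu]_s \int[mu]_x
    (f (replace (lshift T.+1 r) s x, tnth s (lshift T.+1 r)))%:E)%E.
  exact: (ge0_integral_swap (fun=> mu) (lshift T.+1 r) mfE).
have sumq : (\sum_(r < N) q <= 1)%E.
  rewrite (eq_bigr _ (fun r _ => qE r)) -ge0_integral_sum//; first last.
  - by move=> r s _; apply: integral_ge0 => x _.
  - by move=> r; apply: (measurable_integral_EFin mu (h := fun s x =>
      f (replace (lshift T.+1 r) s x, tnth s (lshift T.+1 r)))) => [|? ?];
      [exact: mr|exact: f0].
  apply: (@le_trans _ _ (\int[nu]_s \int[mu]_x 1)%E); last first.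
    by rewrite !integral_probability_cst.
  have m1 (s : samples) (r : 'I_N) : measurable_fun setT (fun x =>
      f (replace (lshift T.+1 r) s x, tnth s (lshift T.+1 r))).
    have ms : measurable_fun setT (fun x : profile R n m => (s, x)).
      by apply: measurable_fun_pair.
    exact: (measurableT_comp (mr (lshift T.+1 r)) ms).
  apply: ge0_le_integral => //.
  - move=> s _; apply: sume_ge0 => r _; exact: integral_ge0.
  - apply: emeasurable_sum => r.
    by apply: (measurable_integral_EFin mu (h := fun s x =>
      f (replace (lshift T.+1 r) s x, tnth s (lshift T.+1 r)))) => [|? ?];
      [exact: mr|exact: f0].
  - move=> s _; rewrite -ge0_integral_EFin_sum//; last exact: m1.
    apply: le_integral_EFin => //.
    - by apply: measurable_sum => r; exact: m1.
    - by move=> x; exact: sumr_ge0.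
    move=> x; rewrite /f /=.
    have [r rP|none] := pickP (fun r : 'I_N => price_scale
      (replace (lshift T.+1 r) s x) < total_value (tnth s (lshift T.+1 r))); last first.
      by rewrite big1// => r _; rewrite none.
    rewrite (bigD1 r)//= rP big1 ?addr0// => r' r'r; apply/eqP.
    rewrite pnatr_eq0 eqb0 -leNgt.
    (* Event [r] puts the total of sample [r] above that of sample [r'], while the sum tested by
       [r'] contains the total of sample [r]; so event [r'] fails. *)
    apply: le_trans (_ : total_value (tnth s (lshift T.+1 r)) <= _).
      apply: le_trans (ltW rP); rewrite /price_scale (bigD1 r')//=.
      rewrite tnth_replace (inj_eq (@lshift_inj _ _)) (negbTE r'r) lerDl.
      by apply: sumr_ge0 => *; exact: sumr_ge0.
    rewrite /price_scale (bigD1 r)//=.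
    rewrite tnth_replace (inj_eq (@lshift_inj _ _)) eq_sym (negbTE r'r) lerDl.
    by apply: sumr_ge0 => *; exact: sumr_ge0.
have q0 : (0 <= q)%E.
  by rewrite /q; apply: integral_ge0 => u _; exact: integral_ge0.
have N0R : 0 < N%:R :> R by rewrite ltr0n.
move: sumq q0; case: (q) => [c|+ _|//].
  rewrite sumEFin sumr_const card_ord -(mulr_natl c) !lee_fin => Nc _.
  by rewrite -[leRHS]mulr1 ler_pdivlMl.
rewrite (bigD1 (Ordinal N0))//= addye ?leye_eq//.
by rewrite gt_eqF// (@lt_le_trans _ _ 0%E)// sume_ge0.
Qed.

End simulated_welfare.

(** * The guarantee *)

(** Continuity of [P] from above along the events [q < f x], which decrease to the empty set. *)
Lemma probability_tail {R : realType} d (T : measurableType d)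
    (P : probability T R) (f : T -> R) (e : R) :
  measurable_fun setT f -> 0 < e ->
  exists2 Q : R, 0 <= Q & ((1 - e)%:E <= P [set x | (f x <= Q)%R])%E.
Proof.
move=> mf e0; pose F (q : nat) := [set x | q%:R < f x].
have mF q : measurable (F q).
  rewrite -[X in measurable X]setTI.
  have mb := measurable_fun_ltr (@measurable_cst _ _ T _ setT (q%:R : R)) mf.
  exact: (mb measurableT [set true]).
have F0 : \bigcap_q F q = set0.
  apply/seteqP; split => // x /= Fx.
  have := Fx (Num.truncn `|f x|).+1 I; rewrite /F /= ltNge.
  move=> /negP; apply; apply: le_trans (ler_norm _) _.
  by apply/ltW/truncnS_gt.
have cvgF : (P \o F) x @[x --> \oo] --> (0 : \bar R)%E.
  rewrite -(measure0 P) -F0; apply: nonincreasing_cvg_mu => //.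
  - by rewrite (le_lt_trans (probability_le1 _ _))// ltry.
  - exact: bigcap_measurable.
  - move=> a b ab; apply/subsetPset => x; rewrite /F /=.
    by apply: le_lt_trans; rewrite ler_nat.
have [q qe] : exists q, (P (F q) <= e%:E)%E.
  have e0' : (0 < e%:E)%E by rewrite lte_fin.
  have := cvgF [set x | (x < e%:E)%E] (open_ereal_lt' e0').
  move=> [q _ qP]; exists q; apply/ltW; exact: (qP q (leqnn q)).
exists q%:R => //.
have -> : [set x | f x <= q%:R] = ~` F q.
  by apply/seteqP; split => x /=; rewrite leNgt => /negP.
rewrite probability_setC// EFinB.
exact: leeB.
Qed.

Lemma lee_unscale {R : realType} (t c a : R) (x y z : \bar R) : 0 < t ->
  (0 <= y)%E -> (0 <= (t * a)%:E * z)%E ->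
  ((t * c)%:E * x <= y + (t * a)%:E * z)%E ->
  (c%:E * x <= t^-1%:E * y + a%:E * z)%E.
Proof.
move=> t0 y0 z0.
have it0 : (0 <= t^-1%:E :> \bar R)%E by rewrite lee_fin invr_ge0 ltW.
move/(lee_wpmul2l it0); rewrite ge0_muleDr// !muleA -!EFinM.
by rewrite !mulKf ?gt_eqF.
Qed.

Section guarantee.
Context {R : realType} {n m : nat} (N T K L : nat).
Variable D : 'I_n -> probability (setfun R m) R.
Hypothesis D_xos : forall i, {ae D i, forall v, xos v}.
Hypotheses (N_gt0 : (0 < N)%N) (K_gt0 : (0 < K)%N) (L_gt0 : (0 < L)%N).
Hypothesis T_def : T.+1 = (K.+1 * K.+2 ^ 2)%N.

Local Notation mu := (prod_prob D).
Local Notation nu := (prod_prob (fun _ : 'I_(N + T.+1) => mu)).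
Local Notation samples := ((N + T.+1).-tuple (profile R n m)).

(** The share of the optimum secured per round before rare sales are charged: one half, less the
    grid error and the effect of sales below the scale. *)
Let kappa : R := 1 / 2 - 3 / 2 / K%:R - 1 / L%:R.

Definition rare_sales (s : samples) : R :=
  \sum_(t < T.+1) (price_scale s < total_value (round_profile s t))%R%:R.

Lemma simulated_welfare_ge v s : (forall i, xos (tnth v i)) ->
  (forall r i, xos (tnth (tnth s r) i)) ->
  opt v * (T.+1%:R * kappa - rare_sales s) -
    2 * m%:R * T.+1%:R * grid_step K L s <= simulated_welfare K L v s.
Proof.
move=> vx sx.
apply: (sum_ghost_welfare_ge (T := T.+1) K_gt0 L_gt0 T_def
  (price_scale_ge0 s)) => //.
move=> t i tT; rewrite (round_profile_ord s (Ordinal tT)).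
by have [] := sx (rshift N (Ordinal tT)) i.
Qed.

Lemma measurable_price_scale_id : measurable_fun setT (@price_scale R n m N T).
Proof. exact: (measurable_price_scale (s := id)). Qed.

Lemma measurable_rare_sales : measurable_fun setT rare_sales.
Proof.
apply: measurable_sum => t; apply: measurable_ltr_indic.
  exact: measurable_price_scale_id.
apply: measurable_total_value; exact: (measurable_round_profile (s := id)).
Qed.

Lemma integral_rare_sales :
  (\int[nu]_s (rare_sales s)%:E <= (T.+1%:R / N%:R)%:E)%E.
Proof.
rewrite ge0_integral_EFin_sum//; last first.
  move=> t; apply: measurable_ltr_indic; first exact: measurable_price_scale_id.
  apply: measurable_total_value; exact: (measurable_round_profile (s := id)).
apply: (@le_trans _ _ (\sum_(t < T.+1) (N%:R^-1)%:E)%E).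
  by apply: lee_sum => t _; exact: rare_sale.
by rewrite sumEFin sumr_const card_ord -(mulr_natl N%:R^-1).
Qed.

Section truncation.
Variable Q : R.

(** Indicator of a bounded scale; it keeps the error term integrable even when the total values have
    infinite mean. *)
Let low (s : samples) : R := (price_scale s <= Q)%R%:R.

Let low0 s : 0 <= low s. Proof. exact: ler0n. Qed.

Let mlow : measurable_fun setT low.
Proof.
apply: (measurable_levels_fun (F := fun s => price_scale s <= Q)
  (G := fun (b : bool) (_ : samples) => b%:R : R)) => //.
apply: measurable_levels_bool; apply: measurable_fun_ler => //.
exact: measurable_price_scale_id.
Qed.

Let lowE : (\int[nu]_s (low s)%:E = nu [set s | (price_scale s <= Q)%R])%E.
Proof.
have mQ : measurable [set s : samples | (price_scale s <= Q)%R].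
  rewrite -[X in measurable X]setTI.
  have mb := measurable_fun_ler measurable_price_scale_id
    (@measurable_cst _ _ samples _ setT Q).
  exact: (mb measurableT [set true]).
transitivity (\int[nu]_s (\1_[set s | (price_scale s <= Q)%R] s)%:E)%E; last first.
  by rewrite integral_indic// setIT.
apply: eq_integral => s _; rewrite indicE /low; congr ((_ : bool)%:R)%:E.
by apply/idP/idP => [?|]; rewrite inE.
Qed.

Definition truncated_scale : \bar R :=
  (\int[nu]_s (price_scale s * low s)%:E)%E.

Let ts0 s : 0 <= price_scale s * low s.
Proof. by rewrite mulr_ge0// price_scale_ge0. Qed.

Let mts : measurable_fun setT (fun s => price_scale s * low s).
Proof. by apply: measurable_funM => //; exact: measurable_price_scale_id. Qed.

Lemma truncated_scale_le : 0 <= Q -> (truncated_scale <= Q%:E)%E.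
Proof.
move=> Q0; rewrite -[leRHS](integral_probability_cst nu).
apply: le_integral_EFin => // s; rewrite /low.
by case: (leP (price_scale s) Q) => [sQ|_]; rewrite ?mulr1// mulr0.
Qed.

(** Each of the [N] scale samples has mean total value at most [n] times the expected optimum. *)
Lemma truncated_scale_le_opt :
  (truncated_scale <= (N * n)%:R%:E * expected_opt D)%E.
Proof.
apply: (@le_trans _ _ (\int[nu]_s (price_scale s)%:E)%E).
  apply: le_integral_EFin => //; first exact: measurable_price_scale_id.
  by move=> s; rewrite ler_piMr ?price_scale_ge0// /low; case: (_ <= Q).
have mtv : measurable_fun setT (@total_value R n m).
  exact: (measurable_total_value (x := id)).
have tv0 (x : profile R n m) : 0 <= total_value x by exact: sumr_ge0.
rewrite ge0_integral_EFin_sum//; last first.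
  move=> r; apply: measurable_total_value; exact: measurable_tnth.
have E r : (\int[nu]_s (total_value (tnth s (lshift T.+1 r)))%:E <=
    n%:R%:E * expected_opt D)%E.
  rewrite (ge0_integral_tnth (fun=> mu) (lshift T.+1 r)
    (measurable_EFin_fun mtv)); last by move=> x; rewrite lee_fin.
  rewrite -ge0_integral_EFinZ//; last 2 first.
  - exact: measurable_opt.
  - exact: opt_ge0.
  apply: ae_le_integral_EFin => //.
  - by apply: measurable_funM => //; exact: measurable_opt.
  - by move=> x; rewrite mulr_ge0// opt_ge0.
  apply: filterS (ae_xos_profile D_xos) => x xx.
  by apply: total_value_le => i; have [] := xx i.
apply: (@le_trans _ _ (\sum_(r < N) (n%:R%:E * expected_opt D))%E).
  by apply: lee_sum => r _; exact: E.
have : (0 <= expected_opt D)%E.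
  by apply: integral_ge0 => x _; rewrite lee_fin opt_ge0.
case: (expected_opt D) => [w _|_|]; last by [].

  by rewrite sumEFin lee_fin sumr_const card_ord natrM -mulrA [leRHS]mulr_natl.
have [n0|n0] := posnP n.
  by rewrite [in leRHS]n0 muln0 mul0e big1// => r _; rewrite [in n%:R]n0 mul0e.
by rewrite [leRHS]gt0_muley ?leey// lte_fin ltr0n muln_gt0 N_gt0.
Qed.

(** The pathwise bound is integrated over the samples of bounded scale; elsewhere the simulated
    welfare is only known to be nonnegative. The errors stand on the larger side because the
    integrals may be infinite. *)
Lemma integral_simulated_welfare_ge v (e : R) : (forall i, xos (tnth v i)) ->
  0 <= kappa -> 0 <= e -> ((1 - e)%:E <= nu [set s | (price_scale s <= Q)%R])%E ->
  ((T.+1%:R * (kappa * (1 - e) - N%:R^-1) * opt v)%:E <=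
   \int[nu]_s (simulated_welfare K L v s)%:E +
   (2 * m%:R * T.+1%:R * (L%:R / K%:R))%:E * truncated_scale)%E.
Proof.
move=> vx k0 e0 Qe; set c := 2 * m%:R * T.+1%:R * (L%:R / K%:R).
have c0 : 0 <= c by rewrite !mulr_ge0.
have o0 := opt_ge0 v.
have rs0 s : 0 <= rare_sales s by exact: sumr_ge0.
have sw0 := @simulated_welfare_ge0 R n m N T K L v.
have msw : measurable_fun setT (simulated_welfare (N := N) (T := T) K L v).
  exact: (measurable_simulated_welfare _ _ (v := fun=> v) (s := id)).
have mcts : measurable_fun setT (fun s => c * (price_scale s * low s)).
  exact: measurable_funM.
have mors : measurable_fun setT (fun s => opt v * rare_sales s).
  by apply: measurable_funM => //; exact: measurable_rare_sales.
have : ((opt v * T.+1%:R * kappa)%:E * \int[nu]_s (low s)%:E <=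
    \int[nu]_s (simulated_welfare K L v s)%:E + c%:E * truncated_scale +
    (opt v)%:E * \int[nu]_s (rare_sales s)%:E)%E.
  have ok0 : 0 <= opt v * T.+1%:R * kappa by rewrite !mulr_ge0.
  rewrite /truncated_scale -(ge0_integral_EFinZ nu ok0 mlow low0).
  rewrite -(ge0_integral_EFinZ nu c0 mts ts0).
  rewrite -(ge0_integral_EFinZ nu o0 measurable_rare_sales rs0).
  have cts0 s : 0 <= c * (price_scale s * low s) by rewrite mulr_ge0.
  have ors0 s : 0 <= opt v * rare_sales s by rewrite mulr_ge0.
  rewrite -(ge0_integral_EFinD nu msw mcts sw0 cts0).
  rewrite -(ge0_integral_EFinD nu (measurable_funD msw mcts) mors _ ors0);
    last by move=> s; exact: addr_ge0.
  apply: ae_le_integral_EFin => //.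
  - exact: measurable_funM.
  - by apply: measurable_funD => //; exact: measurable_funD.
  - by move=> s; rewrite !mulr_ge0.
  - by move=> s; rewrite !addr_ge0// mulr_ge0.
  apply: filterS (ae_xos_samples N T D_xos) => s sx.
  have := simulated_welfare_ge vx sx; rewrite /low /=.
  case: (leP (price_scale s) Q) => _; rewrite ?mulr0 ?mulr1.
    by rewrite /c /grid_step; lra.
  by move=> _; rewrite addr0 addr_ge0// mulr_ge0.
rewrite lowE => main.
have lhs : ((opt v * T.+1%:R * kappa * (1 - e))%:E <=
    (opt v * T.+1%:R * kappa)%:E * nu [set s | (price_scale s <= Q)%R])%E.
  by rewrite EFinM lee_wpmul2l// lee_fin !mulr_ge0.
have rhs : ((opt v)%:E * \int[nu]_s (rare_sales s)%:E <=
    (opt v * (T.+1%:R / N%:R))%:E)%E.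
  by rewrite EFinM lee_wpmul2l ?lee_fin// integral_rare_sales.
have := le_trans (le_trans lhs main) (leeD2l _ rhs).
rewrite -leeBlDr//; apply: le_trans.
by rewrite -EFinB lee_fin; lra.
Qed.

End truncation.

(** The error [b] carries two bounds: its comparison with the optimum serves when the expected
    optimum is finite, its finiteness when it is infinite. *)
Lemma expected_welfare_ge (e : R) : 0 <= kappa -> 0 < e ->
  0 <= kappa * (1 - e) - N%:R^-1 ->
  exists b : \bar R, [/\ b \is a fin_num,
    (b <= (2 * m%:R * (L%:R / K%:R) * (N * n)%:R)%:E * expected_opt D)%E &
    ((kappa * (1 - e) - N%:R^-1)%:E * expected_opt D <=
     expected_welfare (learned_prices N T K L) D + b)%E].
Proof.
move=> k0 e0 c0; set c := kappa * (1 - e) - N%:R^-1 in c0 *.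
have [Q Q0 Qe] := probability_tail nu measurable_price_scale_id e0.
set a := 2 * m%:R * (L%:R / K%:R).
have a0 : 0 <= a by rewrite !mulr_ge0.
have ts0 : (0 <= truncated_scale Q)%E.
  by apply: integral_ge0 => s _; rewrite lee_fin mulr_ge0// price_scale_ge0.
exists (a%:E * truncated_scale Q)%E; split.
- rewrite fin_numM// ge0_fin_numE//.
  exact: le_lt_trans (truncated_scale_le Q0) (ltry _).
- rewrite -/a [X in (_ <= X * _)%E]EFinM -muleA lee_wpmul2l ?lee_fin//.
  exact: truncated_scale_le_opt.
apply: le_trans (leeD2r _ (simulated_le_expected_welfare N T K L D_xos)).
have T0 : 0 < T.+1%:R :> R by rewrite ltr0n.
have mS : measurable_fun setT (fun z : profile R n m * samples =>
    simulated_welfare K L z.1 z.2).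
  by apply: measurable_simulated_welfare; [exact: measurable_fst|exact: measurable_snd].
have mH : measurable_fun setT (fun v =>
    \int[nu]_s (simulated_welfare K L v s)%:E)%E.
  by apply: measurable_integral_EFin => // *; exact: simulated_welfare_ge0.
have H0 v : (0 <= \int[nu]_s (simulated_welfare K L v s)%:E)%E.
  by apply: integral_ge0 => s _; rewrite lee_fin simulated_welfare_ge0.
have B0 : (0 <= (T.+1%:R * a)%:E * truncated_scale Q)%E.
  by rewrite mule_ge0// lee_fin mulr_ge0.
have main : ((T.+1%:R * c)%:E * expected_opt D <=
    \int[mu]_v (\int[nu]_s (simulated_welfare K L v s)%:E) +
    (T.+1%:R * a)%:E * truncated_scale Q)%E.
  rewrite -[X in (_ <= _ + X)%E](integral_probability_cst mu) -ge0_integralD//.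
  rewrite -ge0_integral_EFinZ//; last 3 first.
  - by rewrite mulr_ge0.
  - exact: measurable_opt.
  - exact: opt_ge0.
  apply: ae_ge0_le_integral => //.
  - by move=> v _; rewrite lee_fin !mulr_ge0// opt_ge0.
  - apply: measurable_EFin_fun; apply: measurable_funM => //.
    exact: measurable_opt.
  - by move=> v _; rewrite adde_ge0.
  - exact: emeasurable_funD.
  apply: filterS (ae_xos_profile D_xos) => v vx _.
  have -> : T.+1%:R * a = 2 * m%:R * T.+1%:R * (L%:R / K%:R) by rewrite /a; ring.
  by apply: integral_simulated_welfare_ge => //; exact: ltW.
apply: lee_unscale T0 _ B0 main.
by apply: integral_ge0 => v _; exact: H0.
Qed.

End guarantee.

(** For finite [x] the error is charged to the slack between [g] and [c]; for infinite [x] a finite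
    [b] forces [y] to be infinite. *)
Lemma lee_absorb {R : realType} (c g a : R) (x y b : \bar R) : 0 < c ->
  g + a <= c -> (0 <= x)%E -> b \is a fin_num -> (b <= a%:E * x)%E ->
  (c%:E * x <= y + b)%E -> (g%:E * x <= y)%E.
Proof.
move=> c0 gac; case: b => [b|//|//]; case: x => [x|_|//].
  rewrite lee_fin => x0 _; rewrite -!EFinM lee_fin => bx.
  by case: y => [y|//|]; rewrite ?leey// -EFinD !lee_fin; nra.
move=> _ _; rewrite gt0_muley ?lte_fin//.
by case: y => [y||]; rewrite ?leey.
Qed.

Theorem theorem1p3 (R : realType) (eps : R) (eps_gt0 : 0 < eps) :
  exists P : {poly {poly R}},
    forall n m : nat, (0 < n)%N -> (0 < m)%N ->
    exists (k : nat) (M : mechanism R n m k),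
      k%:R <= P.[(n%:R)%:P].[m%:R] /\
      forall D : 'I_n -> probability (setfun R m) R,
        (forall i, {ae D i, forall v, xos v}) ->
        (((2 + eps)^-1)%:E * expected_opt D <= expected_welfare M D)%E.
Proof.
(* The losses add up to at most [5 / a], which must fit into [1 / 2 - 1 / (2 + eps) = eps / (2 * (2
   + eps))]. *)
pose a := (Num.truncn (10 * (2 + eps) / eps)).+1.
have a_eps : 10 * (2 + eps) / eps < a%:R by exact: truncnS_gt.
have a_gt10 : 10 < a%:R :> R.
  apply: lt_trans a_eps; rewrite ltr_pdivlMr// ltr_pM2l//; lra.
(* The outer variable stands for [n] and the inner one for [m], so [Kp] evaluates to [K]; the
   polynomial is exactly the number of samples. *)
pose Kp : {poly {poly R}} := (2 * a ^ 3)%:R * 'X%:P * 'X.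
exists (a%:R + (Kp + 1) * (Kp + 2%:R) ^+ 2) => n m n0 m0.
(* With [N = L = a] this makes the error factor [2 m (L / K) (N n)] equal to [1 / a]. *)
pose K := (2 * a ^ 3 * m * n)%N.
have K0 : (0 < K)%N by rewrite !muln_gt0 n0 m0.
pose T := (K.+1 * K.+2 ^ 2).-1.
have TE : T.+1 = (K.+1 * K.+2 ^ 2)%N by rewrite prednK.
exists (a + T.+1)%N, (learned_prices a T K a); split.
  rewrite TE natrD natrM natrX -natr1 -[K.+2]addn2 natrD /K !natrM /Kp.
  rewrite !(hornerE, horner_exp) /=.
  have natE k : (k%:R : {poly {poly R}}).[(n%:R)%:P].[m%:R] = k%:R.
    by rewrite -polyC_natr hornerC -polyC_natr hornerC.
  by rewrite !natE !natrM.
move=> D D_xos.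
have a0 : 0 < a%:R :> R by rewrite ltr0n.
have K0R : 0 < K%:R :> R by rewrite ltr0n.
(* At once [1 / N], [1 / L], the probability allowed for a large scale, and the error factor. *)
set u : R := a%:R^-1.
have u0 : 0 < u by rewrite invr_gt0.
have uu : a%:R * u = 1 by rewrite mulfV// gt_eqF.
have u10 : u < 1 / 10 by nra.
have KE : K%:R = 2 * a%:R ^+ 3 * m%:R * n%:R :> R by rewrite !natrM; ring.
have Ku : 1 / K%:R <= u / 2.
  rewrite ler_pdivrMr//; apply: (@le_trans _ _ (u / 2 * (2 * a)%:R)).
    by rewrite natrM; lra.
  rewrite ler_wpM2l ?divr_ge0 ?(ltW u0)// ler_nat /K expnS -!mulnA.
  by rewrite !leq_pmul2l// leq_pmulr// !muln_gt0 n0 m0.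
set kappa : R := 1 / 2 - 3 / 2 / K%:R - 1 / a%:R.
have kappa_ge : 1 / 2 - 2 * u <= kappa.
  by rewrite /kappa (_ : 1 / a%:R = u) ?div1r//; lra.
have c_ge : 1 / 2 - 4 * u <= kappa * (1 - u) - u by nra.
have e2 : 0 < 2 + eps by lra.
(* Four multiples of [u] are spent in [c_ge], the fifth on the error [b]. *)
have g_le : (2 + eps)^-1 + 5 * u <= 1 / 2.
  rewrite -(ler_pM2l e2) mulrDr mulfV ?gt_eqF//.
  by move: a_eps; rewrite ltr_pdivrMr// -(ltr_pM2l u0); nra.
have g0 : 0 < (2 + eps)^-1 by rewrite invr_gt0; lra.
have k0 : 0 <= kappa by lra.
have c0 : 0 <= kappa * (1 - u) - u by lra.
have [b [bfin bE main]] := expected_welfare_ge (N := a) (L := a) D_xos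
  isT K0 isT TE k0 u0 c0.
apply: (@lee_absorb _ (kappa * (1 - u) - u) _ u _ _ b) => //.
- lra.
- lra.
- by apply: integral_ge0 => v _; rewrite lee_fin opt_ge0.
- move: bE; congr (_ <= _%:E * _)%E; rewrite KE natrM /u; field.
  by rewrite !pnatr_eq0 -!lt0n n0 m0.
Qed.
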